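(* Let $n\ge 3$. The bijection $\varphi:\mathrm{Vert}(CP_{n+1})\to \mathrm{Vert}(\mathcal{CP}_{n+1})$ extends to a combinatorial isomorphism between the cell complex $CP_{n+1}$ and the cyclopermutohedron $\mathcal{CP}_{n+1}$ (that is, to a dimension- and incidence-preserving bijection between the cells of $CP_{n+1}$ and the proper faces of $\mathcal{CP}_{n+1}$). More precisely, the following holds: (1) A subset $V\subset \mathrm{Vert}(CP_{n+1})$ is the vertex set of some cell of the complex $CP_{n+1}$ if and only if $\varphi(V)$ is the vertex set of some proper face of $\mathcal{CP}_{n+1}$. (2) For $k=0,\dots,n-2$, the $k$-faces of $\mathcal{CP}_{n+1}$ can be labeled bijectively by all possible cyclically ordered partitions of the set $[n+1]$ into $n-k+1$ non-empty parts. (3) With this labeling, a proper face $F'$ is a face of a proper face $F$ if and only if the label of $F'$ refines the label of $F$.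
   Context: $[m]=\{1,\dots,m\}$. Cyclically ordered partitions. A cyclically ordered partition of a finite set is a partition into non-empty parts together with a cyclic (oriented) order of the parts; it is written as a string $(I_1,\dots,I_k)$ modulo cyclic rotation $(I_1,\dots,I_k)=(I_k,I_1,\dots,I_{k-1})$. $\lambda'$ refines $\lambda$ if $\lambda'$ is obtained from $\lambda$ by replacing each part by a (linearly) ordered partition of that part into one or more non-empty parts, keeping the cyclic order (order-preserving refinement; $\lambda$ refines itself). The complex $CP_{n+1}$. It is the regular cell complex whose $k$-dimensional cells, $k=0,\dots,n-2$, are labeled by all cyclically ordered partitions of $[n+1]$ into $n-k+1$ non-empty parts, a closed cell $F$ containing a cell $F'$ if and only if the label of $F'$ refines the label of $F$. Its vertices are thus labeled by the cyclic orderings of $[n+1]$. The vertex set of a cell is the set of $0$-cells contained in it. Virtual polytopes. Convex polytopes (convex hulls of finite non-empty point sets) in $\mathbb{R}^n$ form a cancellative commutative semigroup under Minkowski addition; virtual polytopes are the elements of its Grothendieck group, i.e. formal differences $L-M$ with $L_1-M_1=L_2-M_2$ iff $L_1+M_2=L_2+M_1$. For a convex polytope $K$ and $\xi\in\mathbb{R}^n$, $K^\xi=\{x\in K:\ (x,\xi)\ge (y,\xi)\ \forall y\in K\}$; for a virtual polytope, $(L-M)^\xi:=L^\xi-M^\xi$ (well defined). The virtual polytopes $K^\xi$ are the faces of $K$; $F'$ is a face of $F$ if $F'=F^\eta$ for some $\eta$. The dimension of a virtual polytope is the least dimension of a linear subspace $W$ such that it can be written as $L-M$ with $L$ and $M$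 each lying in a translate of $W$. $k$-faces are $k$-dimensional faces; $0$-faces are vertices (identified with points of $\mathbb{R}^n$, a difference of points $\{a\}-\{b\}$ being the point $\{a-b\}$); the vertex set of a face $F$ is the set of $0$-dimensional faces of $F$. The cyclopermutohedron. Let $e_1,\dots,e_n$ be the standard basis of $\mathbb{R}^n$, $S=(1,\dots,1)$, $R_i=\sum_{j=1}^n(e_i-e_j)$ (the vector with $i$-th coordinate $n-1$ and all other coordinates $-1$), $q_{ij}=[e_i,e_j]$ for $i<j$, and $r_i=[0,R_i]$ (segments). The cyclopermutohedron is the virtual polytope $$\mathcal{CP}_{n+1}=\sum_{i<j}q_{ij}+S-\sum_{i=1}^n r_i .$$ It lies in the hyperplane $x_1+\dots+x_n=n(n+1)/2$ and has dimension $n-1$; its proper faces are the faces $\mathcal{CP}_{n+1}^\xi$ with $\xi$ not a scalar multiple of $(1,\dots,1)$. The bijection $\varphi$. The standard permutohedron $\Pi_n$ is the convex hull of all points obtained by permuting the coordinates of $(1,2,\dots,n)$; the vertex $v=(\sigma(1),\dots,\sigma(n))$ is labeled by the inverse permutation $(\sigma^{-1}(1),\dots,\sigma^{-1}(n))$. One has $\mathrm{Vert}(\mathcal{CP}_{n+1})=\mathrm{Vert}(\Pi_n)$. Given a vertex of $CP_{n+1}$ labeled by a cyclic ordering $\lambda$ of $[n+1]$, let $\overline{\lambda}$ be the linear ordering of $[n]$ obtained by cutting the cycle at $n+1$ and removing $n+1$ (so $\lambda=(\overline\lambda,n+1)$ cyclically). Then $\varphi$ maps this vertex to the vertex of $\Pi_n$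 labeled by $\overline{\lambda}$. *)

(* Defs.v *)
From HB Require Import structures.
From mathcomp Require Import all_boot all_order all_fingroup all_algebra generic_quotient.
From mathcomp Require Import boolp classical_sets functions reals.

Set Implicit Arguments.
Unset Strict Implicit.
Unset Printing Implicit Defensive.

Import Order.TTheory GRing.Theory Num.Theory.

Local Open Scope quotient_scope.

Section CyclicPartitions.
Variable T : finType.
Implicit Type A : {set T}.

Definition ordered_partition A (s : seq {set T}) : bool :=
  uniq s && finset.partition [set:: s] A.

(* [ordered_partition set0 [::]] holds, but the parts of an ordered partition
   are non-empty, so refines below replaces each part by one or more parts. *)
Definition opart := {s : seq {set T} | ordered_partition [set: T] s}.

Definition rot_eq (s t : opart) : bool :=
  [exists i : 'I_(size (val s)).+1, val t == rot i (val s)].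

Lemma rot_eqP (s t : opart) :
  reflect (exists i, val t = rot i (val s)) (rot_eq s t).
Proof.
apply: (iffP existsP) => [[i /eqP ->]|[i ->]]; first by exists i.
have [lei|gti] := leqP i (size (val s)).
  by exists (Ordinal (lei : (i < (size (val s)).+1)%N)).
by exists ord0; rewrite rot0 rot_oversize // ltnW.
Qed.

Lemma rot_eq_refl : reflexive rot_eq.
Proof. by move=> s; apply/rot_eqP; exists 0%N; rewrite rot0. Qed.

Lemma rot_eq_sym : symmetric rot_eq.
Proof.
suff sub (s t : opart) : rot_eq s t -> rot_eq t s.
  by move=> s t; apply/idP/idP; exact: sub.
move=> /rot_eqP[i ti]; apply/rot_eqP; exists (size (val t) - i)%N.
by rewrite ti -[LHS](rotK i) /rotr.
Qed.

Lemma rot_eq_trans : transitive rot_eq.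
Proof.
move=> t s u /rot_eqP[i ti] /rot_eqP[j uj]; apply/rot_eqP.
by exists (rot_add (val s) i j); rewrite uj ti rot_rot_add.
Qed.

Canonical rot_equiv := EquivRel rot_eq rot_eq_refl rot_eq_sym rot_eq_trans.

Definition cpart := {eq_quot rot_eq}.
HB.instance Definition _ : EqQuotient _ rot_eq cpart := EqQuotient.on cpart.
HB.instance Definition _ := Choice.on cpart.

Definition nparts (l : cpart) : nat := size (val (repr l)).

Definition refines (l' l : cpart) : Prop :=
  exists (s' s : opart) (ss : seq (seq {set T})),
    [/\ l' = \pi_cpart s', l = \pi_cpart s,
        all2 ordered_partition (val s) ss & val s' = flatten ss].

End CyclicPartitions.

Local Open Scope classical_set_scope.
Local Open Scope ring_scope.

Section ConvexPolytopes.
Variables (R : realFieldType) (n : nat).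
Implicit Types (I J : finType) (A B C : set 'rV[R]_n) (x y xi : 'rV[R]_n).

Definition dotv x y : R := \sum_i x ord0 i * y ord0 i.

Definition hull I (p : I -> 'rV[R]_n) : set 'rV[R]_n :=
  [set x | exists w : I -> R,
    [/\ forall i, 0 <= w i, \sum_i w i = 1 & x = \sum_i w i *: p i]].

Definition is_polytope A : Prop :=
  exists (I : finType) (p : I -> 'rV[R]_n), (0 < #|I|)%N /\ A = hull p.

Record polytope := Polytope {
  pset :> set 'rV[R]_n;
  pset_polytope : is_polytope pset }.

HB.instance Definition _ := gen_eqMixin polytope.
HB.instance Definition _ := gen_choiceMixin polytope.

Lemma polytope_eq (K L : polytope) : pset K = pset L -> K = L.
Proof.
case: K L => [A pA] [B pB] /= AB; rewrite AB in pA *.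
by congr Polytope; exact: Prop_irrelevance.
Qed.

Lemma dotvDl x y xi : dotv (x + y) xi = dotv x xi + dotv y xi.
Proof.
by rewrite /dotv -big_split; apply: eq_bigr => i _; rewrite mxE mulrDl.
Qed.

Lemma dotv_suml I (w : I -> R) (p : I -> 'rV[R]_n) xi :
  dotv (\sum_i w i *: p i) xi = \sum_i w i * dotv (p i) xi.
Proof.
rewrite /dotv; under eq_bigr => j _ do rewrite summxE mulr_suml.
rewrite exchange_big; apply: eq_bigr => i _; rewrite mulr_sumr.
by apply: eq_bigr => j _; rewrite mxE mulrA.
Qed.

Lemma hull_comp I J (p : J -> 'rV[R]_n) (f : I -> J) :
  hull (p \o f) `<=` hull p.
Proof.
move=> x [w [w0 w1 ->]].
exists (fun j => \sum_(i | f i == j) w i); split.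
- by move=> j; apply: sumr_ge0.
- by rewrite -w1 [RHS](partition_big f xpredT).
rewrite (partition_big f xpredT) //=; apply: eq_bigr => j _.
by rewrite scaler_suml; apply: eq_bigr => i /eqP <-.
Qed.

Lemma hull_pt I (p : I -> 'rV[R]_n) i : hull p (p i).
Proof.
exists (fun j => (j == i)%:R); split.
- by move=> j; rewrite ler0n.
- by rewrite (bigD1 i) //= eqxx big1 ?addr0 // => j /negPf->.
rewrite (bigD1 i) //= eqxx scale1r big1 ?addr0 // => j /negPf ->.
by rewrite scale0r.
Qed.

Lemma hull_jensen I J (p : I -> 'rV[R]_n) (w : J -> R) (q : J -> 'rV[R]_n) :
  (forall j, 0 <= w j) -> \sum_j w j = 1 -> (forall j, hull p (q j)) ->
  hull p (\sum_j w j *: q j).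
Proof.
move=> w0 w1 /choice[u hu]; exists (fun i => \sum_j w j * u j i); split.
- by move=> i; apply: sumr_ge0 => j _; rewrite mulr_ge0 //; case: (hu j).
- rewrite exchange_big -w1 /=; apply: eq_bigr => j _.
  by rewrite -mulr_sumr; case: (hu j) => _ -> _; rewrite mulr1.
under [RHS]eq_bigr => i _ do rewrite scaler_suml.
rewrite exchange_big /=; apply: eq_bigr => j _; case: (hu j) => _ _ ->.
by rewrite scaler_sumr; apply: eq_bigr => i _; rewrite scalerA.
Qed.

Definition minkowski A B : set 'rV[R]_n := [set a + b | a in A & b in B].

Lemma hullD I J (p : I -> 'rV[R]_n) (q : J -> 'rV[R]_n) :
  minkowski (hull p) (hull q) = hull (fun ij : I * J => p ij.1 + q ij.2).
Proof.
apply/seteqP; split=> x /=.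
- move=> [_ [w [w0 w1 ->]] [_ [v [v0 v1 ->]] <-]].
  exists (fun ij => w ij.1 * v ij.2); split.
  + by move=> ij; rewrite mulr_ge0.
  + rewrite -(pair_bigA _ (fun i j => w i * v j)) -w1 /=.
    by apply: eq_bigr => i _; rewrite -mulr_sumr v1 mulr1.
  rewrite -(pair_bigA _ (fun i j => (w i * v j) *: (p i + q j))) /=.
  under [RHS]eq_bigr => i _ do under eq_bigr => j _ do rewrite scalerDr.
  under [RHS]eq_bigr => i _ do rewrite big_split.
  rewrite big_split /=; congr (_ + _).
    apply: eq_bigr => i _.
    by rewrite -scaler_suml -mulr_sumr v1 mulr1.
  rewrite exchange_big /=; apply: eq_bigr => j _.
  by rewrite -scaler_suml -mulr_suml w1 mul1r.
- move=> [u [u0 u1 ->]].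
  have {}u1 : \sum_i \sum_j u (i, j) = 1.
    by rewrite pair_bigA -u1; apply: eq_bigr => -[].
  exists (\sum_i (\sum_j u (i, j)) *: p i).
    by exists (fun i => \sum_j u (i, j)); split=> // i; apply: sumr_ge0.
  exists (\sum_j (\sum_i u (i, j)) *: q j).
    exists (fun j => \sum_i u (i, j)); split=> //; last by rewrite exchange_big.
    by move=> j; apply: sumr_ge0.
  under [RHS]eq_bigr => ij _ do rewrite scalerDr.
  rewrite [RHS]big_split /=; congr (_ + _).
    under eq_bigr => i _ do rewrite scaler_suml.
    by rewrite pair_bigA /=; apply: eq_bigr => -[].
  under eq_bigr => j _ do rewrite scaler_suml.
  by rewrite exchange_big pair_bigA /=; apply: eq_bigr => -[].
Qed.

Lemma minkowski_polytope (K L : polytope) : is_polytope (minkowski K L).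
Proof.
have [I [p [I0 ->]]] := pset_polytope K.
have [J [q [J0 ->]]] := pset_polytope L.
exists (I * J)%type, (fun ij => p ij.1 + q ij.2); split; last exact: hullD.
by rewrite card_prod muln_gt0 I0.
Qed.

Definition padd (K L : polytope) : polytope :=
  Polytope (minkowski_polytope K L).

Lemma hull_polytope I (p : I -> 'rV[R]_n) :
  (0 < #|I|)%N -> is_polytope (hull p).
Proof. by move=> I0; exists I, p. Qed.

Lemma hull_const (x : 'rV[R]_n) : hull (fun _ : unit => x) = [set x].
Proof.
apply/seteqP; split=> y /=; last by move=> ->; exact: (hull_pt _ tt).
by move=> [w [_ w1 ->]]; rewrite -scaler_suml w1 scale1r.
Qed.

Lemma point_polytope x : is_polytope [set x].
Proof. by rewrite -hull_const; apply: hull_polytope; rewrite card_unit. Qed.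

Definition ppoint x : polytope := Polytope (point_polytope x).

Lemma segment_polytope x y :
  is_polytope (hull (fun b : bool => if b then x else y)).
Proof. by apply: hull_polytope; rewrite card_bool. Qed.

Definition segment x y : polytope := Polytope (segment_polytope x y).

Lemma paddA : associative padd.
Proof.
move=> K L M; apply: polytope_eq; apply/seteqP; split=> x /=.
- move=> [k Kk [_ [l Ll [m Mm <-]] <-]].
  by exists (k + l); [exists k => //; exists l | exists m => //; rewrite addrA].
- move=> [_ [k Kk [l Ll <-]] [m Mm <-]].
  by exists k => //; exists (l + m); [exists l => //; exists m | rewrite addrA].
Qed.

Lemma paddC : commutative padd.
Proof.
by move=> K L; apply: polytope_eq; apply/seteqP; split=> x /=;
   move=> [k Kk [l Ll <-]]; exists l => //; exists k => //; rewrite addrC.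
Qed.

Lemma padd0 : left_id (ppoint 0) padd.
Proof.
move=> K; apply: polytope_eq; apply/seteqP; split=> x /=.
  by move=> [_ -> [k Kk <-]]; rewrite add0r.
by move=> Kx; exists 0 => //; exists x => //; rewrite add0r.
Qed.

HB.instance Definition _ := GRing.isNmodule.Build polytope paddA paddC padd0.

Lemma stationary k (P : 'M[R]_k.+1) :
  (forall i j, 0 <= P i j) -> (forall i, \sum_j P i j = 1) ->
  exists pi : 'I_k.+1 -> R, [/\ forall i, 0 <= pi i, \sum_i pi i = 1 &
    forall j, \sum_i pi i * P i j = pi j].
Proof.
move=> P0 P1.
have [v v0 vP] : exists2 v : 'rV[R]_k.+1, v != 0 & v *m P = v.
  have : \det (P - 1%:M) == 0.
    rewrite -det_tr; apply/det0P; exists (const_mx 1).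
      apply/eqP => /matrixP /(_ ord0 ord0) /eqP.
      by rewrite !mxE oner_eq0.
    apply/rowP => i; rewrite !mxE.
    under eq_bigr => j _ do rewrite !mxE mul1r.
    rewrite sumrB P1 (bigD1 i) //= eqxx big1 ?addr0 ?subrr // => j.
    by rewrite eq_sym => /negPf ->.
  move/det0P => [v v0 /eqP]; rewrite mulmxBr mulmx1 subr_eq0 => /eqP vP.
  by exists v.
pose s := \sum_i `|v ord0 i|.
have s0 : 0 < s.
  rewrite lt_def sumr_ge0 // andbT; apply: contra v0 => /eqP s0.
  apply/eqP/rowP => i; rewrite mxE; apply/eqP; rewrite -normr_eq0; apply/eqP.
  exact: (psumr_eq0P _ s0).
have le j : `|v ord0 j| <= \sum_i `|v ord0 i| * P i j.
  rewrite -{1}vP mxE (le_trans (ler_norm_sum _ _ _)) //.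
  by apply: ler_sum => i _; rewrite normrM (ger0_norm (P0 _ _)).
have eqv j : \sum_i `|v ord0 i| * P i j = `|v ord0 j|.
  apply/eqP; rewrite -subr_eq0; apply/eqP.
  have S0 : \sum_j (\sum_i `|v ord0 i| * P i j - `|v ord0 j|) = 0.
    rewrite sumrB exchange_big /=.
    under eq_bigr => i _ do rewrite -mulr_sumr P1 mulr1.
    by rewrite subrr.
  by apply: (psumr_eq0P _ S0) => // i _; rewrite subr_ge0.
exists (fun i => `|v ord0 i| / s); split.
- by move=> i; rewrite divr_ge0 // ltW.
- by rewrite -mulr_suml divff // gt_eqF.
by move=> j; rewrite -eqv mulr_suml; apply: eq_bigr => i _; rewrite mulrAC.
Qed.

Lemma padd_cancel_sub (K L M : polytope) :
  pset (K + M) `<=` pset (L + M) -> pset K `<=` pset L.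
Proof.
have [J [q [J0 LE]]] := pset_polytope L; rewrite LE.
have [I [c [I0 ME]]] := pset_polytope M.
rewrite /= LE ME => sub a Ka.
case kE : #|I| I0 => [//|k] _.
pose e (i : 'I_k.+1) : I := enum_val (cast_ord (esym kE) i).
have e_bij : bijective e.
  apply: (@bij_comp _ _ _ enum_val); first exact: enum_val_bij.
  by exists (cast_ord kE) => i; rewrite ?cast_ordK ?cast_ordKV.
have hyp i : exists bP : 'rV[R]_n * ('I_k.+1 -> R),
    [/\ hull q bP.1, forall j, 0 <= bP.2 j, \sum_j bP.2 j = 1 &
        a + c (e i) = bP.1 + \sum_j bP.2 j *: c (e j)].
  have /sub : minkowski K (hull c) (a + c (e i)).
    by exists a => //; exists (c (e i)) => //; exact: hull_pt.
  move=> [b qb [_ [w [w0 w1 ->]] <-]].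
  exists (b, w \o e); split => //=.
    by rewrite -w1 [RHS](reindex e) //; exact: onW_bij.
  by congr (_ + _); rewrite (reindex e) //; exact: onW_bij.
have {}[bP hbP] := choice hyp.
have [||pi [pi0 pi1 piP]] := @stationary k (\matrix_(i, j) (bP i).2 j).
- by move=> i j; rewrite mxE; case: (hbP i).
- move=> i; under eq_bigr => j _ do rewrite mxE.
  by case: (hbP i).
suff -> : a = \sum_i pi i *: (bP i).1.
  by apply: hull_jensen => // i; case: (hbP i).
have : \sum_i pi i *: (a + c (e i)) =
       \sum_i pi i *: ((bP i).1 + \sum_j (bP i).2 j *: c (e j)).
  by apply: eq_bigr => i _; case: (hbP i) => _ _ _ ->.
under eq_bigr => i _ do rewrite scalerDr.
under [X in _ = X -> _]eq_bigr => i _ do rewrite scalerDr.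
rewrite !big_split /= -scaler_suml pi1 scale1r.
have -> : \sum_i pi i *: (\sum_j (bP i).2 j *: c (e j)) =
          \sum_j pi j *: c (e j).
  under eq_bigr => i _ do rewrite scaler_sumr.
  rewrite exchange_big /=; apply: eq_bigr => j _.
  rewrite -[in RHS]piP scaler_suml; apply: eq_bigr => i _.
  by rewrite mxE scalerA.
exact: addIr.
Qed.

Lemma padd_cancel (K L M : polytope) : K + M = L + M -> K = L.
Proof.
move=> E; apply: polytope_eq; apply/seteqP.
by split; apply: (@padd_cancel_sub _ _ M); rewrite E.
Qed.

Definition face_set xi A : set 'rV[R]_n :=
  [set x | A x /\ forall y, A y -> dotv y xi <= dotv x xi].

Lemma face_set_ex xi (K : polytope) : exists x, face_set xi K x.
Proof.
have [I [p [/card_gt0P[i0 _] ->]]] := pset_polytope K.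
have [i _ hmax] := @arg_maxP _ _ I i0 xpredT (fun i => dotv (p i) xi) isT.
have hi j : dotv (p j) xi <= dotv (p i) xi by exact: hmax.
exists (p i); split; first exact: hull_pt.
move=> _ [w [w0 w1 ->]]; rewrite dotv_suml -[leRHS]mul1r -w1 mulr_suml.
by apply: ler_sum => j _; rewrite ler_wpM2l // hi.
Qed.

Lemma face_set_polytope xi (K : polytope) : is_polytope (face_set xi K).
Proof.
have [I [p [I0 ->]]] := pset_polytope K; have /card_gt0P[i0 _] := I0.
have [i _ hmax] := @arg_maxP _ _ I i0 xpredT (fun i => dotv (p i) xi) isT.
have hi j : dotv (p j) xi <= dotv (p i) xi by exact: hmax.
pose f j := if dotv (p j) xi == dotv (p i) xi then j else i.
have fE j : dotv (p (f j)) xi = dotv (p i) xi by rewrite /f; case: eqP.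
exists I, (p \o f); split=> //; apply/seteqP; split=> x /=.
- move=> [[w [w0 w1 xE]] xmax]; exists w; split=> //.
  have S0 : \sum_j w j * (dotv (p i) xi - dotv (p j) xi) = 0.
    apply/eqP; rewrite eq_le sumr_ge0 ?andbT; last first.
      by move=> j _; rewrite mulr_ge0 // subr_ge0 hi.
    under eq_bigr => j _ do rewrite mulrBr.
    rewrite sumrB -mulr_suml w1 mul1r -dotv_suml -xE subr_le0.
    exact/xmax/hull_pt.
  rewrite xE; apply: eq_bigr => j _; rewrite /f /=; case: eqP => // /eqP ne.
  suff -> : w j = 0 by rewrite !scale0r.
  have /eqP : w j * (dotv (p i) xi - dotv (p j) xi) = 0.
    apply: (psumr_eq0P _ S0) => // l _.
    by rewrite mulr_ge0 // subr_ge0 hi.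
  by rewrite mulf_eq0 subr_eq0 [X in _ || X]eq_sym (negPf ne) orbF => /eqP.
- move=> hx; split; first exact: hull_comp hx.
  move=> y [w [w0 w1 ->]]; case: hx => v [v0 v1 ->].
  rewrite !dotv_suml /=; under [leRHS]eq_bigr => j _ do rewrite fE.
  rewrite -mulr_suml v1 -w1 mulr_suml.
  by apply: ler_sum => j _; rewrite ler_wpM2l // hi.
Qed.

Definition pface xi (K : polytope) : polytope :=
  Polytope (face_set_polytope xi K).

Lemma pfaceD xi : {morph pface xi : K L / K + L}.
Proof.
move=> K L; apply: polytope_eq; apply/seteqP; split=> x /=.
- move=> [[k Kk [l Ll <-]] kl]; exists k.
    split=> // k' Kk'; rewrite -(lerD2r (dotv l xi)) -!dotvDl; apply: kl.
    by exists k' => //; exists l.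
  exists l => //; split=> // l' Ll'.
  rewrite -(lerD2l (dotv k xi)) -!dotvDl; apply: kl.
  by exists k => //; exists l'.
- move=> [k [Kk hk] [l [Ll hl] <-]]; split; first by exists k => //; exists l.
  move=> _ [k' Kk' [l' Ll' <-]]; rewrite !dotvDl.
  by apply: lerD; [exact: hk | exact: hl].
Qed.

Lemma pface_point xi x : pface xi (ppoint x) = ppoint x.
Proof.
apply: polytope_eq; apply/seteqP; split=> y /=; first by case.
by move=> ->; split=> // z ->.
Qed.

End ConvexPolytopes.

Section VirtualPolytopes.
Variables (R : realFieldType) (n : nat).
Local Notation poly := (polytope R n).
Implicit Types (x xi : 'rV[R]_n) (L M : poly).

(* Transitive because Minkowski addition is cancellative (padd_cancel). *)
Definition vequiv (p q : poly * poly) : bool := p.1 + q.2 == q.1 + p.2.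

Lemma vequiv_refl : reflexive vequiv.
Proof. by move=> p; rewrite /vequiv. Qed.

Lemma vequiv_sym : symmetric vequiv.
Proof. by move=> p q; rewrite /vequiv eq_sym. Qed.

Lemma vequiv_trans : transitive vequiv.
Proof.
move=> q p r /eqP pq /eqP qr; apply/eqP; apply: (@padd_cancel _ _ _ _ q.2).
by rewrite addrAC pq addrAC qr addrAC.
Qed.

Canonical vequiv_equiv := EquivRel vequiv vequiv_refl vequiv_sym vequiv_trans.

Definition virtual := {eq_quot vequiv}.
HB.instance Definition _ : EqQuotient _ vequiv virtual := EqQuotient.on virtual.
HB.instance Definition _ := Choice.on virtual.

Definition vdiff L M : virtual := \pi_virtual (L, M).

Lemma vdiff_eq L1 M1 L2 M2 :
  vdiff L1 M1 = vdiff L2 M2 <-> L1 + M2 = L2 + M1.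
Proof.
split=> [/eqP|E]; first by rewrite /vdiff piE /= /vequiv /= => /eqP.
by apply/eqP; rewrite /vdiff piE /= /vequiv /= E.
Qed.

Lemma vdiff_ind (P : virtual -> Prop) :
  (forall L M, P (vdiff L M)) -> forall K, P K.
Proof. by move=> H K; rewrite -[K]reprK; case: (repr K) => L M; exact: H. Qed.

Definition vadd (K1 K2 : virtual) : virtual :=
  vdiff ((repr K1).1 + (repr K2).1) ((repr K1).2 + (repr K2).2).
Definition vopp (K : virtual) : virtual := vdiff (repr K).2 (repr K).1.

Lemma repr_vdiff L M :
  (repr (vdiff L M)).1 + M = L + (repr (vdiff L M)).2.
Proof.
have : vdiff (repr (vdiff L M)).1 (repr (vdiff L M)).2 = vdiff L M.
  by rewrite {1}/vdiff -surjective_pairing reprK.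
by move/vdiff_eq.
Qed.

Lemma vadd_diff L1 M1 L2 M2 :
  vadd (vdiff L1 M1) (vdiff L2 M2) = vdiff (L1 + L2) (M1 + M2).
Proof.
by apply/vdiff_eq; rewrite addrACA !repr_vdiff addrACA.
Qed.

Lemma vopp_diff L M : vopp (vdiff L M) = vdiff M L.
Proof. by apply/vdiff_eq; rewrite addrC -repr_vdiff addrC. Qed.

Lemma vaddA : associative vadd.
Proof.
elim/vdiff_ind => L1 M1; elim/vdiff_ind => L2 M2; elim/vdiff_ind => L3 M3.
by rewrite !vadd_diff !addrA.
Qed.

Lemma vaddC : commutative vadd.
Proof.
elim/vdiff_ind => L1 M1; elim/vdiff_ind => L2 M2.
by rewrite !vadd_diff (addrC L1) (addrC M1).
Qed.

Lemma vadd0 : left_id (vdiff 0 0) vadd.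
Proof. by elim/vdiff_ind => L M; rewrite vadd_diff !add0r. Qed.

Lemma vaddN : left_inverse (vdiff 0 0) vopp vadd.
Proof.
elim/vdiff_ind => L M; rewrite vopp_diff vadd_diff.
by apply/vdiff_eq; rewrite addr0 add0r addrC.
Qed.

HB.instance Definition _ :=
  GRing.isZmodule.Build virtual vaddA vaddC vadd0 vaddN.

Definition vemb L : virtual := vdiff L 0.
Definition vpoint x : virtual := vemb (ppoint x).

Lemma vdiffE L M : vdiff L M = vemb L - vemb M.
Proof.
have -> : - vemb M = vdiff 0 M by exact: vopp_diff.
rewrite [RHS]vadd_diff.
by congr vdiff; rewrite ?addr0 ?add0r.
Qed.

(* Computed on a chosen representative L - M; vface_diff shows that the result
   does not depend on it. *)
Definition vface xi (K : virtual) : virtual :=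
  vdiff (pface xi (repr K).1) (pface xi (repr K).2).

Lemma vface_diff xi L M :
  vface xi (vdiff L M) = vdiff (pface xi L) (pface xi M).
Proof. by apply/vdiff_eq; rewrite -!pfaceD repr_vdiff. Qed.

Definition is_face (F' F : virtual) : Prop := exists eta, F' = vface eta F.

Definition dim_witness (K : virtual) (d : nat) : Prop :=
  exists (W : {vspace 'rV[R]_n}) (L M : poly) (a b : 'rV[R]_n),
    [/\ \dim W = d, K = vdiff L M,
        forall x, pset L x -> x - a \in W & forall x, pset M x -> x - b \in W].

Lemma dim_witness_ex (K : virtual) : exists d, `[< dim_witness K d >].
Proof.
exists (\dim (fullv : {vspace 'rV[R]_n})); apply/asboolP.
elim/vdiff_ind: K => L M; exists fullv, L, M, 0, 0.
by split=> // x _; rewrite memvf.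
Qed.

Definition vdim (K : virtual) : nat := ex_minn (dim_witness_ex K).

Definition vertices (F : virtual) : set virtual :=
  [set v | is_face v F /\ vdim v = 0%N].

End VirtualPolytopes.

Section Cyclopermutohedron.
Variables (R : realFieldType) (n : nat).

Definition basis_vec (i : 'I_n) : 'rV[R]_n := delta_mx ord0 i.
Definition ones : 'rV[R]_n := const_mx 1.
Definition Rvec (i : 'I_n) : 'rV[R]_n :=
  \sum_j (basis_vec i - basis_vec j).

Definition cyclopermutohedron : virtual R n :=
  \sum_(i < n) \sum_(j < n | (i < j)%N)
     vemb (segment (basis_vec i) (basis_vec j))
  + vpoint ones
  - \sum_(i < n) vemb (segment 0 (Rvec i)).

Definition proper_face (F : virtual R n) : Prop :=
  exists xi : 'rV[R]_n,
    (forall c : R, xi <> c *: ones) /\ F = vface xi cyclopermutohedron.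

End Cyclopermutohedron.

(* A cell is identified with its label, and incidence is refinement of labels.
   [n+1] is 'I_n.+1, the element n+1 being ord_max, and i : 'I_n is included in
   [n+1] as lift ord_max i. The dimensions 0, ..., n-2 correspond to
   n+1, ..., 3 parts. *)
Section Complex.
Variable n : nat.

Definition cell := {l : cpart 'I_n.+1 | (3 <= nparts l)%N}.

Definition cell_dim (c : cell) : nat := (n.+1 - nparts (val c))%N.

Definition cell_sub (c' c : cell) : Prop := refines (val c') (val c).

Definition complex_vertices : set cell := [set v | cell_dim v = 0%N].

Definition cell_vertices (c : cell) : set cell :=
  [set v | complex_vertices v /\ cell_sub v c].

(* Cutting a cyclic ordering after n+1 and reading off the elements of [n];
   on a 0-cell every part is a singleton. *)
Definition cut (l : cpart 'I_n.+1) : seq 'I_n :=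
  let s := val (repr l) in
  [seq i | A : {set 'I_n.+1} <- rot (index [set ord_max]%SET s).+1 s,
           i <- [seq i <- enum 'I_n | lift ord_max i \in A]].

Definition perm_vertex (R : realFieldType) (sigma : {perm 'I_n}) : 'rV[R]_n :=
  \row_i (sigma i).+1%:R.

Definition perm_label (sigma : {perm 'I_n}) : seq 'I_n :=
  [seq (sigma^-1)%g j | j <- enum 'I_n].

(* The vertex (sigma(1), ..., sigma(n)) of the permutohedron with label
   (sigma^-1(1), ..., sigma^-1(n)) = cut v : sigma(i) is the position of i in
   cut v. *)
Definition phi (R : realFieldType) (v : cell) : 'rV[R]_n :=
  \row_i (index i (cut (val v))).+1%:R.

Lemma phi_label (R : realFieldType) (v : cell) (sigma : {perm 'I_n}) :
  cut (val v) = perm_label sigma -> phi R v = perm_vertex R sigma.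
Proof.
move=> E; apply/rowP => i; rewrite !mxE E /perm_label; congr (_.+1%:R).
rewrite -{1}(permK sigma i) index_map; last exact: perm_inj.
by rewrite index_enum_ord.
Qed.

End Complex.

Arguments complex_vertices n : clear implicits.

(* Main.v *)
Require Import Defs.
From mathcomp Require Import all_boot all_order all_algebra generic_quotient.
From mathcomp Require Import zify lra.
From mathcomp Require Import boolp classical_sets functions reals.
From mathcomp Require Import fintype finset.

Set Implicit Arguments.
Unset Strict Implicit.
Unset Printing Implicit Defensive.

Import Order.TTheory GRing.Theory Num.Theory.

(** The whole argument rests on one computation of a face.  To a direction xi
attach n+1 numbers: n times the deviation of each coordinate of xi from their
mean, which is the scalar product with R_i, and 0 for the extra element n+1.
The face of q_ij in direction xi is the endpoint with the larger value, or all
of q_ij if the values agree; the face of r_i is R_i, 0 or all of r_i according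
to the sign of the deviation of i.  Now R_i is the sum over j of e_i - e_j, so
subtracting R_i for every i above the mean exchanges, in the sum of the chosen
endpoints, e_i and e_j exactly for those pairs in which one of i, j is above
the mean and the other is not.  This is the same as moving the elements above
the mean from the top of the order to the bottom, that is, as cutting the
cyclic order of the n+1 values just after the extra element.  Hence the face
depends only on the cyclically ordered partition of [n+1] into level sets.

Accordingly a cyclically ordered partition is encoded by the rank function
obtained by cutting it after the part of n+1, which thereby has the largest
rank (cyclic_rank).  Every rank function r for which n+1 has the largest rank
defines a virtual polytope face_of r: the point S, all q_ij with i, j of equal
rank and the larger endpoint of the other q_ij, minus the r_i for i in the part
of n+1.  The
constant function gives the cyclopermutohedron itself, and vface_face_of says
that the faces of face_of r are again of this form: the part of n+1 is split
into what lies above 0, which is moved to the front, and the rest, and ties are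
then broken by xi.  That is a refinement of cyclically ordered partitions
(refines_cyclic_rank); conversely every refinement of a cell, and every
partition with at least three parts as a refinement of the trivial one, comes
from some direction (refinement_direction, proper_direction).

The label can be recovered from the virtual polytope: faces in generic
directions are points whose coordinates are positions in a linear order, and
suitable generic directions tell apart two different partitions, provided
n >= 3 (face_of_inj).  So labels, incidence and vertices correspond as claimed.

For the dimension of a face, an upper bound comes from the space spanned by the
full segments in its description.  For the lower bound, if the face is L - M
with L and M in translates of W, then every xi orthogonal to W fixes the face;
by injectivity such a xi breaks no tie (fixed_face), so W contains everything
orthogonal to the directions that break no tie. *)

(** * Ranks for lexicographic orders *)
Section LexRank.
Variables (T : finType) (d : Order.disp_t) (O : orderType d).
Implicit Types (b : T -> nat) (g : T -> O).

Definition lexlt b g : rel T :=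
  fun x y => (b x < b y)%N || (b x == b y) && (g x < g y)%O.

Definition lexrank b g (x : T) : nat := #|[set z | lexlt b g z x]|.

Lemma lexlt_trans b g : transitive (lexlt b g).
Proof.
move=> y x z; rewrite /lexlt.
case: (ltngtP (b x) (b y)) => // [xy|->] /= H; case: (ltngtP (b y) (b z)) => //=.
- by move=> /(ltn_trans xy) ->.
- by move=> <-; rewrite xy.
- by move=> _ ; exact: lt_trans.
Qed.

Lemma lexlt_cotrans b g x y : ~~ lexlt b g x y ->
  forall z, lexlt b g z y -> lexlt b g z x.
Proof.
rewrite /lexlt => + z; case: (ltngtP (b x) (b y)) => //= [xy _|->].
  case: (ltngtP (b z) (b y)) => //= [zy _|-> _]; last by rewrite xy.
  by rewrite (ltn_trans zy xy).
rewrite -leNgt => yx; case: (ltngtP (b z) (b y)) => //= _ zy.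
exact: lt_le_trans zy yx.
Qed.

(** Counting predecessors turns any strict weak order on a finite type into a
natural-valued rank, so that orders involving the reals and orders involving
positions of parts can be handled alike. *)
Lemma lexrankE b g x y : (lexrank b g x < lexrank b g y)%N = lexlt b g x y.
Proof.
apply/idP/idP => [|xy].
  rewrite ltnNge; apply: contraR => nxy; apply/subset_leq_card/subsetP => z.
  by rewrite !inE; exact: lexlt_cotrans.
apply/proper_card/properP; split.
  by apply/subsetP => z; rewrite !inE => zx; exact: lexlt_trans zx xy.
by exists x; rewrite !inE // /lexlt ltnn eqxx ltxx.
Qed.

End LexRank.

Lemma all2_map (U V W : Type) (r : V -> W -> bool) (f : U -> V) (g : U -> W) w :
  all2 r (map f w) (map g w) = all (fun u => r (f u) (g u)) w.
Proof. by elim: w => //= u w ->. Qed.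

Lemma flatten_filter_key (U : Type) (k : U -> nat) (w : seq U) m :
  sorted (relpre k leq) w ->
  flatten [seq [seq u <- w | k u == i] | i <- iota 0 m] =
  [seq u <- w | (k u < m)%N].
Proof.
have ktr : transitive (relpre k leq) by move=> y x z; exact: leq_trans.
have split_key (v : seq U) p : sorted (relpre k leq) v ->
    v = [seq u <- v | (k u < p)%N] ++ [seq u <- v | (p <= k u)%N].
  elim: v => //= u v IH uv; rewrite {1}IH ?(path_sorted uv) // (leqNgt p).
  have [//|pu /=] := ltnP (k u) p.
  have uw := order_path_min ktr uv.
  have {}uw : all (fun x => p <= k x)%N v.
    by move: uw; apply: sub_all => z; exact: leq_trans.
  have -> : [seq z <- v | (k z < p)%N] = [::].
    apply/size0nil/eqP; rewrite size_filter -leqn0 leqNgt -has_count -all_predC.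
    by move: uw; apply: sub_all => z /=; rewrite -leqNgt.
  by rewrite (all_filterP uw).
move=> sw; elim: m => [|m IH]; first by rewrite /= filter_pred0.
rewrite -[m.+1]addn1 iotaD map_cat flatten_cat IH /= cats0 add0n.
rewrite [RHS](split_key _ m); last exact: sorted_filter.
rewrite -!filter_predI; congr (_ ++ _); apply: eq_filter => u /=; lia.
Qed.

(** * Ordered partitions and positions of elements *)
Section OrderedPartitions.
Variable T : finType.
Implicit Types (A B C : {set T}) (s t : seq {set T}) (x y : T).

Lemma ordered_partitionP A s :
  reflect [/\ uniq s, set0 \notin s,
              forall x, x \in A <-> (exists2 B, B \in s & x \in B) &
              forall x B C, B \in s -> C \in s -> x \in B -> x \in C -> B = C]
          (ordered_partition A s).
Proof.
apply: (iffP andP) => [[us /and3P[/eqP cov /trivIsetP tr n0]]|[us n0 cov dis]].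
  split=> //; first by rewrite inE in n0.
    move=> x; rewrite -cov; split=> [/bigcupP|] [B].
      by rewrite inE => Bs xB; exists B.
    by move=> Bs xB; apply/bigcupP; exists B; rewrite ?inE.
  move=> x B C Bs Cs xB xC; apply/eqP/contraT => BC.
  have := tr B C; rewrite !inE => /(_ Bs Cs BC).
  by rewrite disjoints_subset => /subsetP/(_ x xB); rewrite inE xC.
split=> //; apply/and3P; split; last by rewrite inE.
  apply/eqP/setP => x; apply/bigcupP/idP => [[B]|/cov[B Bs xB]].
    by rewrite inE => Bs xB; apply/cov; exists B.
  by exists B; rewrite ?inE.
apply/trivIsetP => B C; rewrite !inE => Bs Cs BC.
rewrite disjoints_subset; apply/subsetP => x xB; rewrite inE.
by apply: contra BC => xC; apply/eqP; exact: (dis x).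
Qed.

Definition part_index s x : nat := find (fun A : {set T} => x \in A) s.

Section Positions.
Variable s : opart T.
Local Notation pos := (part_index (val s)).

Lemma part_index_lt x : (pos x < size (val s))%N.
Proof.
rewrite -has_find; have /ordered_partitionP[_ _ cov _] := valP s.
have /cov[B Bs xB] : x \in [set: T] by rewrite inE.
by apply/hasP; exists B.
Qed.

Lemma mem_nth_part i x :
  (i < size (val s))%N -> (x \in nth set0 (val s) i) = (pos x == i).
Proof.
move=> si; have /ordered_partitionP[us _ _ dis] := valP s.
have sx := part_index_lt x.
have xpos : x \in nth set0 (val s) (pos x).
  by apply: (nth_find set0 (a := fun A => x \in A)); rewrite has_find.
apply/idP/eqP => [xi|<- //].
apply/eqP; rewrite -(nth_uniq set0 sx si us); apply/eqP.
by apply: (dis x) => //; exact: mem_nth.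
Qed.

Lemma part_index_onto i :
  (i < size (val s))%N -> exists x, pos x = i.
Proof.
move=> si; have /ordered_partitionP[_ n0 _ _] := valP s.
have : nth set0 (val s) i != set0.
  by apply: contra n0 => /eqP <-; exact: mem_nth.
by case/set0Pn => x; rewrite mem_nth_part // => /eqP; exists x.
Qed.

Lemma size_opart : (size (val s) <= #|T|)%N.
Proof.
rewrite -[leqLHS]card_ord.
pose f x := Ordinal (part_index_lt x).
apply: leq_trans (leq_image_card f T); apply/subset_leq_card/subsetP => i _.
have [x xi] := part_index_onto (ltn_ord i).
by apply/codomP; exists x; apply: val_inj.
Qed.

End Positions.

(** The positions of the elements form an initial segment of the naturals, so
they are determined by how they compare, and they determine the parts. *)
Lemma part_index_inj (s t : opart T) :
  (forall x y, (part_index (val s) x < part_index (val s) y)%N =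
               (part_index (val t) x < part_index (val t) y)%N) ->
  s = t.
Proof.
move=> st.
have le (s1 s2 : opart T) :
    (forall x y, (part_index (val s1) x < part_index (val s1) y)%N =
               (part_index (val s2) x < part_index (val s2) y)%N) ->
    forall m x, part_index (val s1) x = m -> (m <= part_index (val s2) x)%N.
  move=> s12; elim=> // m IH x xm.
  have [|y ym] := @part_index_onto s1 m.
    by have := part_index_lt s1 x; rewrite xm; exact: ltnW.
  by rewrite (leq_ltn_trans (IH y ym)) // -s12 ym xm.
have eqi x : part_index (val s) x = part_index (val t) x.
  by apply/eqP; rewrite eqn_leq !(le _ _ _ _ x erefl).
have lesz (s1 s2 : opart T) : part_index (val s1) =1 part_index (val s2) ->
    (size (val s1) <= size (val s2))%N.
  move=> s12; rewrite leqNgt; apply/negP => /part_index_onto[x].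
  by rewrite s12 => x2; have := part_index_lt s2 x; rewrite x2 ltnn.
have sz : size (val s) = size (val t).
  by apply/eqP; rewrite eqn_leq !lesz // => x; rewrite eqi.
apply: val_inj; apply: (@eq_from_nth _ set0) => // i si.
by apply/setP => x; rewrite !mem_nth_part -?sz // eqi.
Qed.

Lemma part_index_surj (f : T -> nat) :
  exists s : opart T, forall x y,
    (part_index (val s) x < part_index (val s) y)%N = (f x < f y)%N.
Proof.
pose vs := sort leq (undup (codom f)).
have memvs x : f x \in vs by rewrite mem_sort mem_undup codom_f.
have uvs : uniq vs by rewrite sort_uniq undup_uniq.
pose s := [seq [set x | f x == v] | v <- vs].
have os : ordered_partition [set: T] s.
  apply/ordered_partitionP; split.
  - rewrite map_inj_in_uniq // => v w.
    rewrite !mem_sort !mem_undup => /codomP[x ->] /codomP[y ->] /setP/(_ x).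
    by rewrite !inE eqxx => /esym/eqP.
  - apply/negP => /mapP[v]; rewrite mem_sort mem_undup => /codomP[x ->].
    by move/setP/(_ x); rewrite !inE eqxx.
  - move=> x; rewrite inE; split=> // _; exists [set y | f y == f x].
      exact: map_f.
    by rewrite inE.
  - move=> x B C /mapP[v _ ->] /mapP[w _ ->].
    by rewrite !inE => /eqP -> /eqP ->.
exists (Sub s os) => x y; rewrite SubK.
have E z : part_index s z = index (f z) vs.
  rewrite /part_index find_map; apply: eq_find => v /=.
  by rewrite inE eq_sym.
have slt : sorted ltn vs.
  by rewrite ltn_sorted_uniq_leq uvs; exact: (sort_sorted leq_total).
have lt u v : u \in vs -> v \in vs -> (index u vs < index v vs)%N -> (u < v)%N.
  by move=> us vs'; exact: (sorted_ltn_index ltn_trans slt).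
rewrite !E; apply/idP/idP; first exact: lt.
move=> xy; rewrite ltnNge leq_eqVlt negb_or; apply/andP; split.
  apply: contraL xy => /eqP/(congr1 (nth 0%N vs)).
  by rewrite !nth_index // => ->; rewrite ltnn.
by apply: contraL xy => /lt; rewrite -leqNgt => yx; apply/ltnW/yx.
Qed.

Lemma flatten_finer (s : seq {set T}) (ss : seq (seq {set T})) x y :
  all2 (fun A t => ordered_partition A t) s ss ->
  (part_index s x < part_index s y)%N ->
  (part_index (flatten ss) x < part_index (flatten ss) y)%N.
Proof.
have hasE A t z : ordered_partition A t ->
    has (fun B : {set T} => z \in B) t = (z \in A).
  case/ordered_partitionP => _ _ cov _.
  by apply/hasP/idP => [[B Bt zB]|/cov[B Bt zB]]; [apply/cov; exists B | exists B].
elim: s ss => [|A s IH] [|t ss] //= /andP[At sss].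
rewrite /part_index /= !find_cat !(hasE _ _ _ At).
case: ifP => xA; case: ifP => yA //.
  by rewrite ltn_addr // -(has_find (fun B : {set T} => x \in B)) (hasE A).
by rewrite ltnS ltn_add2l; exact: IH.
Qed.

(** Since the finer order respects the coarser one, all elements of a part B of
s' have the same position in s; grouping the parts of s' by this position
cuts s' into an ordered partition of each part of s. *)
Lemma finer_flatten (s s' : opart T) :
  (forall x y, (part_index (val s) x < part_index (val s) y)%N ->
               (part_index (val s') x < part_index (val s') y)%N) ->
  exists2 ss, all2 (fun A t => ordered_partition A t) (val s) ss &
              val s' = flatten ss.
Proof.
move=> fin.
have /ordered_partitionP[us' n0' cov' dis'] := valP s'.
pose k B := if [pick x in B] is Some x then part_index (val s) x else 0%N.
have kE B x : B \in val s' -> x \in B -> k B = part_index (val s) x.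
  move=> Bs xB; rewrite /k; case: pickP => [y yB|/(_ x)]; last by rewrite xB.
  have same z : z \in B -> part_index (val s') z = index B (val s').
    by move=> zB; apply/eqP; rewrite -mem_nth_part ?index_mem // nth_index.
  by apply/eqP; case: ltngtP => // /fin; rewrite !same ?ltnn.
have ne B : B \in val s' -> exists x, x \in B.
  by move=> Bs; apply/set0Pn; apply: contra n0' => /eqP <-.
have sk : sorted (relpre k leq) (val s').
  apply/pairwise_sorted/(pairwiseP set0) => i j; rewrite !inE => si sj ij.
  have [[x xi] [y yj]] := (ne _ (mem_nth set0 si), ne _ (mem_nth set0 sj)).
  rewrite /= (kE _ _ _ xi) ?(kE _ _ _ yj) ?mem_nth // leqNgt.
  apply: contraL ij => /fin.
  move: xi yj; rewrite !mem_nth_part // => /eqP -> /eqP ->.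
  by rewrite -leqNgt; exact: ltnW.
have kl B : B \in val s' -> (k B < size (val s))%N.
  by move=> Bs; have [x xB] := ne _ Bs; rewrite (kE _ x) ?part_index_lt.
exists [seq [seq B <- val s' | k B == i] | i <- iota 0 (size (val s))]; last first.
  by rewrite flatten_filter_key //; apply/esym/all_filterP/allP.
rewrite -[X in all2 _ X](mkseq_nth set0) all2_map; apply/allP => i.
rewrite mem_iota add0n /= => si; apply/ordered_partitionP; split.
- exact: filter_uniq.
- by rewrite mem_filter (negPf n0') andbF.
- move=> x; rewrite mem_nth_part //; split=> [/eqP xi|[B]].
    have /cov'[B Bs xB] : x \in [set: T] by rewrite inE.
    by exists B => //; rewrite mem_filter Bs (kE _ _ Bs xB) xi eqxx.
  by rewrite mem_filter => /andP[/eqP <- Bs] xB; rewrite (kE _ _ Bs xB).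
- by move=> x B C; rewrite !mem_filter => /andP[_ Bs] /andP[_ Cs]; exact: dis'.
Qed.

Lemma rot_opart_subproof i (s : opart T) :
  ordered_partition [set: T] (rot i (val s)).
Proof.
have /ordered_partitionP[us n0 cov dis] := valP s.
apply/ordered_partitionP; split; rewrite ?rot_uniq ?mem_rot //.
  move=> x; rewrite cov.
  by split=> -[B]; rewrite ?mem_rot; exists B; rewrite ?mem_rot.
by move=> x B C; rewrite !mem_rot; exact: dis.
Qed.

Definition rot_opart i (s : opart T) : opart T :=
  exist _ (rot i (val s)) (rot_opart_subproof i s).

Lemma part_index_rot i (s : opart T) x : (i <= size (val s))%N ->
  part_index (rot i (val s)) x =
  (if (part_index (val s) x < i)%N
   then part_index (val s) x + (size (val s) - i)
   else part_index (val s) x - i)%N.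
Proof.
move=> si; apply/eqP.
have hlt := part_index_lt s x.
set p := part_index (val s) x in hlt *.
pose q := if (p < i)%N then (p + (size (val s) - i))%N else (p - i)%N.
have hq : (q < size (rot i (val s)))%N.
  by rewrite size_rot /q; case: ifP; lia.
rewrite -(@mem_nth_part (rot_opart i s)) // /= /rot nth_cat size_drop.
rewrite /q; case: (ltnP p i) => pi.
  by rewrite ltnNge leq_addl /= addnK nth_take // mem_nth_part ?(leq_trans pi).
by rewrite ltn_sub2r ?(leq_ltn_trans pi) // nth_drop subnKC // mem_nth_part.
Qed.

End OrderedPartitions.

(** * Cyclically ordered partitions as rank functions *)
Section CyclicRanks.
Variables (T : finType) (x0 : T).
Implicit Types (l : cpart T) (x y : T).
Local Open Scope quotient_scope.

Definition cut_after (s : opart T) : opart T :=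
  rot_opart (part_index (val s) x0).+1 s.

(** Cutting after the part of the base point selects one linear order out of
each class of rotations, in which the base point has the largest rank. *)
Definition cyclic_rank l x : nat := part_index (val (cut_after (repr l))) x.

Lemma cut_afterE (s : opart T) x :
  part_index (val (cut_after s)) x =
  (if (part_index (val s) x <= part_index (val s) x0)%N
   then part_index (val s) x + (size (val s) - (part_index (val s) x0).+1)
   else part_index (val s) x - (part_index (val s) x0).+1)%N.
Proof. by rewrite /= part_index_rot ?part_index_lt. Qed.

Lemma pi_cut_after (s : opart T) : \pi_(cpart T) (cut_after s) = \pi s.
Proof.
apply/eqP; rewrite eq_sym piE; apply/rot_eqP.
by exists (part_index (val s) x0).+1.
Qed.

Lemma repr_pi (s : opart T) :
  exists2 i, (i <= size (val s))%N &
    val (repr (\pi_(cpart T) s)) = rot i (val s).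
Proof.
have /eqP : \pi_(cpart T) s = \pi_(cpart T) (repr (\pi_(cpart T) s)).
  by rewrite reprK.
rewrite piE => /existsP[i /eqP ->]; exists i => //; by rewrite -ltnS.
Qed.

Lemma cyclic_rank_piE (s : opart T) x :
  cyclic_rank (\pi_(cpart T) s) x = part_index (val (cut_after s)) x.
Proof.
have [i si E] := repr_pi s.
rewrite /cyclic_rank !cut_afterE E size_rot !part_index_rot //.
move: (part_index_lt s x) (part_index_lt s x0).
set N := size _ in si *; set p := part_index _ x; set p0 := part_index _ x0.
move: N si p p0 => N si p p0 hx h0 {E}.
by case: (ltnP p i) => ?; case: (ltnP p0 i) => ?; case: (leqP p p0) => ?;
  case: leqP => ?; lia.
Qed.

(** What comes after the base point in a representative is read first. *)
Lemma cyclic_rank_pi (s : opart T) x y :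
  (cyclic_rank (\pi_(cpart T) s) x < cyclic_rank (\pi_(cpart T) s) y)%N =
  lexlt (fun z => (part_index (val s) z <= part_index (val s) x0)%N)
    (part_index (val s)) x y.
Proof.
rewrite !cyclic_rank_piE !cut_afterE /lexlt ltEnat /=.
move: (part_index_lt s x) (part_index_lt s y) (part_index_lt s x0).
set N := size _; set px := part_index _ x; set py := part_index _ y.
set p0 := part_index _ x0; move: N px py p0 => N px py p0 hx hy h0.
by case: (leqP px p0) => ?; case: (leqP py p0) => ?; lia.
Qed.

Lemma cyclic_rank_inj l l' :
  (forall x y, (cyclic_rank l x < cyclic_rank l y)%N =
               (cyclic_rank l' x < cyclic_rank l' y)%N) ->
  l = l'.
Proof.
move=> E; rewrite -[l]reprK -[l']reprK -pi_cut_after -[RHS]pi_cut_after.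
by rewrite (@part_index_inj _ (cut_after (repr l)) (cut_after (repr l'))).
Qed.

Lemma nparts_cyclic_rank l : nparts l = (cyclic_rank l x0).+1.
Proof.
rewrite /cyclic_rank cut_afterE leqnn; have := part_index_lt (repr l) x0.
by rewrite /nparts; lia.
Qed.

Lemma cyclic_rank_max l x : (cyclic_rank l x <= cyclic_rank l x0)%N.
Proof.
rewrite -ltnS -nparts_cyclic_rank /nparts.
rewrite -(size_rot (part_index (val (repr l)) x0).+1).
exact: part_index_lt (cut_after (repr l)) x.
Qed.

Lemma cyclic_rank_onto l i :
  (i <= cyclic_rank l x0)%N -> exists x, cyclic_rank l x = i.
Proof.
rewrite -ltnS -nparts_cyclic_rank => il.
by apply: part_index_onto (cut_after (repr l)) _ _; rewrite size_rot.
Qed.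

Lemma cyclic_rank_surj (f : T -> nat) : (forall x, (f x <= f x0)%N) ->
  exists l, forall x y, (cyclic_rank l x < cyclic_rank l y)%N = (f x < f y)%N.
Proof.
move=> fmax; have [s sf] := part_index_surj f.
exists (\pi_(cpart T) s) => x y; rewrite cyclic_rank_pi /lexlt.
have le z : (part_index (val s) z <= part_index (val s) x0)%N.
  by rewrite leqNgt sf -leqNgt.
by rewrite !le ltEnat /= sf.
Qed.

(** The elements in mv are detached from the last part and put in front: going
around the cycle, they are met just after the cut. *)
Definition split_rank (mv : pred T) (r : T -> nat) x :=
  if mv x then 0%N else (r x).+1.

(** Refinement of cyclic orders in terms of the linear orders obtained by
cutting them: a plain refinement once the detached elements have been put in
front. *)
Definition rank_refines (r' r : T -> nat) := exists mv : pred T,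
  [/\ mv x0 = false, forall x, mv x -> r x = r x0 &
      forall x y, (split_rank mv r x < split_rank mv r y)%N -> (r' x < r' y)%N].

(** Refining the part of the base point may place some of its elements after
the base point.  The cut then falls in the middle of that part, and these
elements become the first ones; all other comparisons are merely refined. *)
Lemma refines_cyclic_rank l' l :
  refines l' l <-> rank_refines (cyclic_rank l') (cyclic_rank l).
Proof.
split=> [[s' [s [ss [-> -> sss s'E]]]]|[mv [mv0 mvtop fin]]].
  have fin x y : (part_index (val s) x < part_index (val s) y)%N ->
                 (part_index (val s') x < part_index (val s') y)%N.
    by rewrite s'E; exact: flatten_finer sss.
  pose mv x := (part_index (val s) x == part_index (val s) x0) &&
               (part_index (val s') x0 < part_index (val s') x)%N.
  exists mv; split=> [|x|x y].
  - by rewrite /mv ltnn andbF.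
  - move=> /andP[/eqP xx0 _]; apply/eqP; case: ltngtP => //.
      by rewrite cyclic_rank_pi /lexlt xx0 ltEnat /= !ltnn andbF.
    by rewrite cyclic_rank_pi /lexlt xx0 ltEnat /= !ltnn andbF.
  - rewrite /split_rank /mv cyclic_rank_pi /lexlt ltEnat /=.
    rewrite !cyclic_rank_piE !cut_afterE.
    move: (fin x y) (fin x x0) (fin x0 x) (fin y x0) (fin x0 y).
    move: (part_index_lt s x) (part_index_lt s y) (part_index_lt s x0).
    move: (size _) (part_index (val s) x) (part_index (val s) y).
    move: (part_index (val s) x0) (part_index (val s') x).
    move: (part_index (val s') y) (part_index (val s') x0).
    move=> qy q0 p0 qx N px py hx hy h0.
    case: (ltngtP px p0) => [?|?|->]; case: (ltngtP py p0) => [?|?|->];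
      case: (leqP qx q0) => ?; case: (leqP qy q0) => ? /=; rewrite ?ltnn ?leqnn; lia.
(* Putting the detached elements back to the end of l' gives a representative
   that refines the cut representative of l without any rotation. *)
have [s' s'E] := part_index_surj (lexrank mv (cyclic_rank l')).
have mvle x : (part_index (val s') x <= part_index (val s') x0)%N = ~~ mv x.
  rewrite leqNgt s'E lexrankE /lexlt mv0 ltEnat /=.
  by case: (mv x); rewrite //= ltnNge cyclic_rank_max.
have <- : \pi_(cpart T) s' = l'.
  apply: cyclic_rank_inj => x y; rewrite cyclic_rank_pi /lexlt !mvle ltEnat /=.
  rewrite s'E lexrankE /lexlt ltEnat /=.
  have := fin x y; have := fin y x; rewrite /split_rank.
  by case: (mv x); case: (mv y) => //=; lia.
have [x y|ss] := @finer_flatten _ (cut_after (repr l)) s'.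
  rewrite s'E lexrankE /lexlt ltEnat /= -![part_index _ _]/(cyclic_rank l _) => xy.
  have := fin x y; rewrite /split_rank.
  have := mvtop x; have := mvtop y.
  have := cyclic_rank_max l x; have := cyclic_rank_max l y.
  by case: (mv x); case: (mv y) => //=; lia.
exists s', (cut_after (repr l)), ss; split=> //.
by rewrite pi_cut_after reprK.
Qed.

End CyclicRanks.

Local Open Scope ring_scope.

(** * Faces and dimension of virtual polytopes *)
Section Polytopes.
Variables (R : realFieldType) (n : nat).
Local Notation V := 'rV[R]_n.
Implicit Types (x y xi : V) (K L M : polytope R n) (F : virtual R n).
Implicit Type W : {vspace V}.

Lemma dotvBl x y xi : dotv (x - y) xi = dotv x xi - dotv y xi.
Proof.
by rewrite /dotv -sumrB; apply: eq_bigr => i _; rewrite !mxE mulrBl.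
Qed.

Lemma dotvZl (a : R) x xi : dotv (a *: x) xi = a * dotv x xi.
Proof.
by rewrite /dotv mulr_sumr; apply: eq_bigr => i _; rewrite !mxE mulrA.
Qed.

Lemma dotv_basis i xi : dotv (basis_vec R i) xi = xi ord0 i.
Proof.
rewrite /dotv (bigD1 i) //= !mxE !eqxx mul1r big1 ?addr0 // => j ji.
by rewrite !mxE (negPf ji) andbF mul0r.
Qed.

Lemma ppointD x y : ppoint (x + y) = ppoint x + ppoint y.
Proof.
apply: polytope_eq; apply/seteqP; split=> z /=.
  by move=> ->; exists x => //; exists y.
by move=> [_ -> [_ -> <-]].
Qed.

Lemma ppoint_sum (I : finType) (P : pred I) (f : I -> V) :
  ppoint (\sum_(i | P i) f i) = \sum_(i | P i) ppoint (f i).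
Proof. exact: (big_morph (@ppoint R n) ppointD erefl). Qed.

Lemma ppoint_inj : injective (@ppoint R n).
Proof.
move=> x y /(congr1 (@pset R n)) /= xy.
by have : [set y]%classic x by rewrite -xy.
Qed.

Lemma vpoint_inj : injective (@vpoint R n).
Proof.
by move=> x y /vdiff_eq; rewrite !addr0; exact: ppoint_inj.
Qed.

Lemma vembD K L : vemb (K + L) = vemb K + vemb L.
Proof. by rewrite [RHS]vadd_diff addr0. Qed.

Lemma vemb_sum (I : finType) (P : pred I) (f : I -> polytope R n) :
  vemb (\sum_(i | P i) f i) = \sum_(i | P i) vemb (f i).
Proof. exact: (big_morph (@vemb R n) vembD erefl). Qed.

Lemma pface_sum (I : finType) (P : pred I) (f : I -> polytope R n) xi :
  pface xi (\sum_(i | P i) f i) = \sum_(i | P i) pface xi (f i).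
Proof. exact: (big_morph (pface xi) (pfaceD xi) (pface_point xi 0)). Qed.

Lemma segmentP x y z :
  pset (segment x y) z <->
  exists t : R, [/\ 0 <= t, t <= 1 & z = t *: x + (1 - t) *: y].
Proof.
split=> [[w [w0 w1 ->]]|[t [t0 t1 ->]]].
  rewrite big_bool /= in w1; exists (w true); split=> //.
    by rewrite -w1 lerDl.
  by rewrite big_bool /= -w1 [_ + w false]addrC addrK.
exists (fun b => if b then t else 1 - t); split.
- by case=> //; rewrite subr_ge0.
- by rewrite big_bool /= addrC subrK.
- by rewrite big_bool.
Qed.

Lemma pface_segment xi x y :
  pface xi (segment x y) =
  if dotv x xi < dotv y xi then ppoint y
  else if dotv y xi < dotv x xi then ppoint x else segment x y.
Proof.
have px : pset (segment x y) x.
  by apply/segmentP; exists 1; rewrite subrr scale1r scale0r addr0.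
have py : pset (segment x y) y.
  by apply/segmentP; exists 0; rewrite subr0 scale1r scale0r add0r.
apply: polytope_eq; apply/seteqP; split=> z.
  move=> [/segmentP[t [t0 t1 ->]] zmax].
  have := zmax x px; have := zmax y py; rewrite dotvDl !dotvZl => hy hx.
  case: ltgtP => xy /=.
  - have -> : t = 0 by nra.
    by rewrite subr0 scale1r scale0r add0r.
  - have -> : t = 1 by nra.
    by rewrite subrr scale1r scale0r addr0.
  - by apply/segmentP; exists t.
have le u : pset (segment x y) u -> exists t : R,
    [/\ 0 <= t, t <= 1 & dotv u xi = t * dotv x xi + (1 - t) * dotv y xi].
  by move=> /segmentP[t [t0 t1 ->]]; exists t; rewrite dotvDl !dotvZl.
case: ltgtP => xy /=.
- by move=> ->; split=> // u /le[t [t0 t1 ->]]; nra.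
- by move=> ->; split=> // u /le[t [t0 t1 ->]]; nra.
- move=> zs; split=> // u /le[t [t0 t1 ->]].
  by have [s [s0 s1 ->]] := le _ zs; nra.
Qed.

Definition in_translate W K := exists a, forall x, pset K x -> x - a \in W.

Lemma in_translate_point W x : in_translate W (ppoint x).
Proof. by exists x => _ ->; rewrite subrr mem0v. Qed.

Lemma in_translate_segment W x y : x - y \in W -> in_translate W (segment x y).
Proof.
move=> xyW; exists y => z /segmentP[t [_ _ ->]].
suff -> : t *: x + (1 - t) *: y - y = t *: (x - y) by rewrite memvZ.
by rewrite scalerBl scale1r scalerBr addrA addrAC addrK.
Qed.

Lemma in_translateD W K L :
  in_translate W K -> in_translate W L -> in_translate W (K + L).
Proof.
move=> [a Ka] [b Lb]; exists (a + b) => _ [x Kx [y Ly <-]].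
by rewrite opprD addrACA memvD ?Ka ?Lb.
Qed.

Lemma in_translate_sum W (I : finType) (P : pred I) (f : I -> polytope R n) :
  (forall i, P i -> in_translate W (f i)) ->
  in_translate W (\sum_(i | P i) f i).
Proof.
by move=> Wf; apply: big_ind => //; [exact: in_translate_point|exact: in_translateD].
Qed.

Lemma vdim_le W L M : in_translate W L -> in_translate W M ->
  (vdim (vdiff L M) <= \dim W)%N.
Proof.
move=> [a La] [b Mb]; rewrite /vdim; case: ex_minnP => m _; apply.
by apply/asboolP; exists W, L, M, a, b.
Qed.

Lemma pface_orthogonal W K xi : in_translate W K ->
  (forall x, x \in W -> dotv x xi = 0) -> pface xi K = K.
Proof.
move=> [a Ka] Wxi; apply: polytope_eq; apply/seteqP; split=> z; first by case.
move=> Kz; split=> // y Ky.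
rewrite -subr_le0 -dotvBl Wxi //.
by rewrite -(subrKA a) -[a - z]opprB memvB ?Ka.
Qed.

(** A coordinate of the component of x transverse to W is a linear form that
vanishes on W. *)
Lemma separate (W : {vspace V}) x : x \notin W ->
  exists xi, (forall y, y \in W -> dotv y xi = 0) /\ dotv x xi != 0.
Proof.
move=> xW; pose g y : V := y - projv W y.
have gW y : y \in W -> g y = 0 by move=> yW; rewrite /g projv_id ?subrr.
have : g x != 0.
  by apply: contra xW; rewrite subr_eq0 => /eqP ->; exact: memv_proj.
case/rV0Pn => j gxj; exists (\row_i g (basis_vec R i) ord0 j).
have gE y : dotv y (\row_i g (basis_vec R i) ord0 j) = g y ord0 j.
  rewrite [in RHS](row_sum_delta y) /g linear_sum -sumrB summxE.
  by apply: eq_bigr => i _; rewrite !mxE linearZ /= !mxE mulrBr.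
by split=> [y yW|]; rewrite gE // gW // mxE.
Qed.

(** If F = L - M with L and M in translates of W', each xi orthogonal to W' is
constant on L and on M, hence fixes F; so W is orthogonal to the orthogonal
complement of W', and thus contained in W'. *)
Lemma vdim_ge (W : {vspace V}) F :
  (forall xi, vface xi F = F -> forall x, x \in W -> dotv x xi = 0) ->
  (\dim W <= vdim F)%N.
Proof.
move=> fixW; rewrite /vdim; case: ex_minnP => m /asboolP[W' [L [M [a [b]]]]] + _.
move=> [<- FE La Mb]; apply/dimvS/subvP => x xW.
apply: contraT => /separate[xi [W'xi]].
rewrite fixW ?eqxx // FE vface_diff.
by rewrite !(@pface_orthogonal W') //; [exists b | exists a].
Qed.

End Polytopes.

(** * The faces of the cyclopermutohedron *)
Lemma sum_pairs (V : nmodType) n (F : 'I_n -> 'I_n -> V) : (forall i, F i i = 0) ->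
  \sum_i \sum_j F i j = \sum_(i < n) \sum_(j < n | (i < j)%N) (F i j + F j i).
Proof.
move=> F0.
have -> : \sum_i \sum_j F i j =
    \sum_(i < n) \sum_(j < n | (i < j)%N) F i j +
    \sum_(i < n) \sum_(j < n | (j < i)%N) F i j.
  rewrite -big_split; apply: eq_bigr => i _.
  rewrite (bigID (fun j : 'I_n => (i < j)%N)) /=; congr (_ + _).
  rewrite (bigD1 i) ?ltnn //= F0 add0r; apply: eq_bigl => j.
  by rewrite -leqNgt [RHS]ltn_neqAle andbC.
rewrite [X in _ + X](exchange_big_dep xpredT) //= -big_split; apply: eq_bigr => i _.
by rewrite -big_split.
Qed.

Lemma eqn_nlt (a b : nat) : (a == b) = ~~ ((a < b) || (b < a))%N.
Proof. by rewrite -neq_ltn negbK. Qed.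

Section Faces.
Variables (R : realFieldType) (n : nat).
Local Notation V := 'rV[R]_n.
Local Notation top := (@ord_max n).
Local Notation up := (lift (@ord_max n)).
Implicit Types (xi : V) (r : 'I_n.+1 -> nat) (x y : 'I_n.+1) (i j : 'I_n).

(** Comparing coordinates of xi with their mean, as comparisons with the value
0 of the extra element; the scaling by n avoids division. *)
Definition deviation xi x : R :=
  if unlift top x is Some i then dotv (Rvec R i) xi else 0.

Lemma deviation_up xi i :
  deviation xi (up i) = n%:R * xi ord0 i - \sum_j xi ord0 j.
Proof.
rewrite /deviation liftK /Rvec /dotv.
under eq_bigr => k _ do rewrite summxE mulr_suml.
rewrite exchange_big /=.
have E j : \sum_k (basis_vec R i - basis_vec R j) ord0 k * xi ord0 k =
           xi ord0 i - xi ord0 j.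
  by rewrite -/(dotv _ _) dotvBl !dotv_basis.
under eq_bigr => j _ do rewrite E.
by rewrite sumrB sumr_const card_ord mulr_natl.
Qed.

Lemma deviation_top xi : deviation xi top = 0.
Proof. by rewrite /deviation unlift_none. Qed.

Lemma deviation_lt xi i j :
  (deviation xi (up i) < deviation xi (up j)) = (xi ord0 i < xi ord0 j).
Proof.
rewrite !deviation_up ltrD2r ltr_pM2l // ltr0n.
by case: n i => // -[].
Qed.

Lemma deviation_eq xi i j :
  deviation xi (up i) = deviation xi (up j) -> xi ord0 i = xi ord0 j.
Proof. by move=> d; apply/eqP; rewrite eq_le !leNgt -!deviation_lt d !ltxx. Qed.

Lemma sum_deviation xi : \sum_i deviation xi (up i) = 0.
Proof.
under eq_bigr => i _ do rewrite deviation_up.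
by rewrite sumrB -mulr_sumr sumr_const card_ord mulr_natl subrr.
Qed.

Lemma deviation_onto (g : 'I_n -> R) : \sum_i g i = 0 ->
  exists xi, forall i, deviation xi (up i) = g i.
Proof.
move=> g0; exists (n%:R^-1 *: \row_i g i) => i; rewrite deviation_up.
under eq_bigr => j _ do rewrite !mxE.
rewrite -mulr_sumr g0 mulr0 subr0 !mxE mulrA divff ?mul1r // pnatr_eq0.
by case: n i {g g0} => // -[].
Qed.

Definition edge r i j : polytope R n :=
  if (r (up i) < r (up j))%N then ppoint (basis_vec R j)
  else if (r (up j) < r (up i))%N then ppoint (basis_vec R i)
  else segment (basis_vec R i) (basis_vec R j).

(** The common shape of all faces: r records for each edge q_ij which end or
whether all of it is selected, and the part of the extra element records the
segments r_i that are still subtracted in full. *)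
Definition face_of r : virtual R n :=
  vdiff (ppoint (ones R n) + \sum_(i < n) \sum_(j < n | (i < j)%N) edge r i j)
        (\sum_(i | r (up i) == r top) segment 0 (Rvec R i)).

Definition moved r xi : pred 'I_n.+1 :=
  fun x => (r x == r top) && (0 < deviation xi x).

(** The elements of the last part above the mean go to the front, and xi breaks
the remaining ties. *)
Definition subrank r xi := lexrank (split_rank (moved r xi) r) (deviation xi).

Lemma subrankE r xi x y :
  (subrank r xi x < subrank r xi y)%N =
  lexlt (split_rank (moved r xi) r) (deviation xi) x y.
Proof. exact: lexrankE. Qed.

Lemma moved_top r xi : moved r xi top = false.
Proof. by rewrite /moved deviation_top ltxx andbF. Qed.

Lemma subrank_max r xi x : (forall x, r x <= r top)%N ->
  (subrank r xi x <= subrank r xi top)%N.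
Proof.
move=> rmax; rewrite leqNgt subrankE /lexlt /split_rank moved_top deviation_top.
rewrite /moved; case: eqP => [->|] /=; last first.
  move=> /eqP ne; rewrite ltnNge ltnS rmax /= eqSS eq_sym (negPf ne) //.
by case: ltP; rewrite ?ltnn ?eqxx.
Qed.

Lemma eq_face_of r r' :
  (forall x y, (r x < r y)%N = (r' x < r' y)%N) -> face_of r = face_of r'.
Proof.
move=> rr'; rewrite /face_of; congr (vdiff (_ + _) _).
  by apply: eq_bigr => i _; apply: eq_bigr => j _; rewrite /edge !rr'.
by apply: eq_bigl => i; rewrite !eqn_nlt !rr'.
Qed.

(** The pairwise form of the key computation: on the left e_i is chosen over
e_j if the deviation of i is larger, whereas moving i but not j to the front
makes j the larger one; e_i - e_j accounts for the difference. *)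
Lemma pface_edge r xi i j : (forall x, r x <= r top)%N ->
  pface xi (edge r i j) = edge (subrank r xi) i j +
    ppoint (((moved r xi (up i))%:R - (moved r xi (up j))%:R) *:
            (basis_vec R i - basis_vec R j)).
Proof.
move=> rmax; rewrite /edge !subrankE /lexlt /split_rank.
have mT x y : (r x < r y)%N -> moved r xi x = false.
  by move=> xy; rewrite /moved ltn_eqF // (leq_trans xy).
case: (ltngtP (r (up i)) (r (up j))) => rij.
- rewrite (mT _ _ rij) pface_point; case mj: (moved r xi (up j)) => /=.
    rewrite -ppointD mulr0n mulr1n sub0r scaleN1r opprB addrC subrK //.
  by rewrite ltnS rij subrr scale0r addr0.
- rewrite (mT _ _ rij) pface_point; case mi: (moved r xi (up i)) => /=.
    rewrite -ppointD mulr0n mulr1n subr0 scale1r addrC subrK //.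
  rewrite !ltnS rij ltnNge (ltnW rij) eqSS gtn_eqF //= subrr scale0r addr0 //.
rewrite pface_segment !dotv_basis -!deviation_lt.
have mE x : moved r xi x = (r x == r top) && (0 < deviation xi x) by [].
rewrite !mE rij; case: (r (up j) == r top); rewrite /=; last first.
  by rewrite ltnn eqxx /= subrr scale0r addr0.
case: (ltP 0 (deviation xi (up i))) => di;
  case: (ltP 0 (deviation xi (up j))) => dj /=; rewrite ?ltnn ?eqxx /=.
- by rewrite subrr scale0r addr0.
- rewrite ltNge (le_trans dj (ltW di)) /= (le_lt_trans dj di).
  by rewrite -ppointD mulr0n mulr1n subr0 scale1r addrC subrK.
- rewrite (le_lt_trans di dj).
  by rewrite -ppointD mulr0n mulr1n sub0r scaleN1r opprB addrC subrK.
- by rewrite subrr scale0r addr0.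
Qed.

(** The subtracted segments r_i with i above the mean shrink to the points R_i;
written as sums over pairs, these points cancel the corrections of
pface_edge. *)
Lemma vface_face_of r xi : (forall x, r x <= r top)%N ->
  vface xi (face_of r) = face_of (subrank r xi).
Proof.
move=> rmax; rewrite vface_diff; apply/vdiff_eq.
rewrite pfaceD pface_point pface_sum.
under eq_bigr => i _ do rewrite pface_sum.
under eq_bigr => i _ do under eq_bigr => j _ do rewrite pface_edge //.
under eq_bigr => i _ do rewrite big_split.
rewrite big_split /= -!addrA; congr (_ + (_ + _)).
rewrite pface_sum.
have -> : \sum_(i | r (up i) == r top) pface xi (segment 0 (Rvec R i)) =
   \sum_(i | subrank r xi (up i) == subrank r xi top) segment 0 (Rvec R i) +
   \sum_(i | moved r xi (up i)) ppoint (Rvec R i).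
  rewrite big_mkcond [X in _ = X + _]big_mkcond [X in _ = _ + X]big_mkcond /=.
  rewrite -big_split; apply: eq_bigr => i _.
  rewrite [subrank _ _ _ == _]eqn_nlt !subrankE /lexlt /split_rank.
  rewrite moved_top deviation_top /moved; case: ifP => [/eqP rt|/negP rt] /=.
    rewrite rt pface_segment.
    have -> : dotv (Rvec R i) xi = deviation xi (up i) by rewrite /deviation liftK.
    have -> : dotv (0 : V) xi = 0 by rewrite /dotv big1 // => k _; rewrite mxE mul0r.
    case: (ltgtP 0 (deviation xi (up i))) => d /=.
    - by rewrite add0r.
    - by rewrite ltnn eqxx /= addr0.
    - by rewrite ltnn eqxx /= addr0.
  by rewrite !ltnS ltn_neqAle rmax andbT; move/negP/negbTE: rt => ->; rewrite addr0.
rewrite addrC; congr (_ + _).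
under eq_bigr => i _ do rewrite -ppoint_sum.
rewrite -!ppoint_sum; congr ppoint.
have D0 i : (moved r xi (up i))%:R *: (basis_vec R i - basis_vec R i) = 0 :> V.
  by rewrite subrr scaler0.
transitivity (\sum_i \sum_j
    (moved r xi (up i))%:R *: (basis_vec R i - basis_vec R j)).
  rewrite (sum_pairs D0).
  apply: eq_bigr => i _; apply: eq_bigr => j _.
  by rewrite scalerBl -[X in _ - _ *: X]opprB scalerN opprK.
rewrite [RHS]big_mkcond; apply: eq_bigr => i _; rewrite -scaler_sumr.
by case: ifP; rewrite ?scale1r ?scale0r.
Qed.

End Faces.

(** * Recovering the label from the face *)
Section EqualityOfFaces.
Variables (R : realFieldType) (n : nat).
Local Notation V := 'rV[R]_n.
Local Notation top := (@ord_max n).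
Local Notation up := (lift (@ord_max n)).
Implicit Types (xi : V) (r : 'I_n.+1 -> nat) (x y : 'I_n.+1) (i j : 'I_n).

Definition rank_vertex r : V := \row_i (#|[set j | (r (up j) < r (up i))%N]|).+1%:R.

Lemma face_of_vertex r : injective r -> face_of R r = vpoint (rank_vertex r).
Proof.
move=> rinj.
have top_up i : (r (up i) == r top) = false.
  by apply/eqP => /rinj /eqP; rewrite eq_sym (negPf (neq_lift _ _)).
rewrite /face_of [X in vdiff _ X]big_pred0 //.
suff -> : ppoint (ones R n) + \sum_(i < n) \sum_(j < n | (i < j)%N) edge R r i j =
          ppoint (rank_vertex r) by [].
pose F i j := (r (up j) < r (up i))%N%:R *: basis_vec R i.
have edgeE i j : (i < j)%N -> edge R r i j = ppoint (F i j + F j i).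
  move=> ij; rewrite /edge /F;
  case: ltngtP => /= [rij|rij|/rinj/(@lift_inj _ _ _ _) e].
  - by rewrite scale0r add0r scale1r.
  - by rewrite scale0r addr0 scale1r.
  - by rewrite e ltnn in ij.
under eq_bigr => i _ do under eq_bigr => j ij do rewrite edgeE //.
under eq_bigr => i _ do rewrite -ppoint_sum.
rewrite -ppoint_sum -sum_pairs => [|i]; last by rewrite /F ltnn scale0r.
rewrite -ppointD; congr ppoint; apply/rowP => k; rewrite !mxE mulrS.
congr (_ + _); rewrite summxE (bigD1 k) //= [X in _ + X]big1 => [|i ik].
  rewrite addr0 summxE -sum1_card natr_sum [RHS]big_mkcond; apply: eq_bigr => j _.
  by rewrite !mxE !eqxx mulr1 inE; case: ifP.
by rewrite summxE big1 // => j _; rewrite !mxE [k == i]eq_sym (negPf ik) andbF mulr0.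
Qed.

Lemma rank_vertex_lt r i j :
  (rank_vertex r ord0 i < rank_vertex r ord0 j) = (r (up i) < r (up j))%N.
Proof.
rewrite !mxE ltr_nat ltnS.
have E k : #|[set j | (r (up j) < r (up k))%N]| = lexrank (fun=> 0%N) (r \o up) k.
  by apply: eq_card => l; rewrite !inE /lexlt /= ?ltEnat.
by rewrite !E lexrankE /lexlt /= ?ltEnat.
Qed.

Lemma subrank_inj r xi : injective (deviation xi) -> injective (subrank r xi).
Proof.
move=> dinj x y; have := subrankE r xi x y; have := subrankE r xi y x.
rewrite /lexlt => + + e.
rewrite e ltnn; case: (ltngtP (split_rank _ _ x)) => //= _.
by case: ltgtP => // /dinj.
Qed.

Lemma eq_face_of_subrank r r' xi i j :
  (forall x, r x <= r top)%N -> (forall x, r' x <= r' top)%N ->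
  face_of R r = face_of R r' -> injective (deviation xi) ->
  (subrank r xi (up i) < subrank r xi (up j))%N =
  (subrank r' xi (up i) < subrank r' xi (up j))%N.
Proof.
move=> rmax rmax' /(congr1 (vface xi)); rewrite !vface_face_of // => E dinj.
move: E; rewrite !face_of_vertex; try exact: subrank_inj.
by move=> /vpoint_inj E; rewrite -!rank_vertex_lt E.
Qed.

(** A single element z above the mean, so that no other element is moved to the
front, and i largest among the others, to decide ties with i as wanted. *)
Lemma generic_direction z i : i != z ->
  exists xi, [/\ injective (deviation xi), 0 < deviation xi (up z),
    forall j, j != z -> deviation xi (up j) < 0 &
    forall j, j != z -> j != i -> deviation xi (up j) < deviation xi (up i)].
Proof.
move=> iz; pose idx j := (index j (i :: enum 'I_n)).+1.
have idxi j : j != i -> (1 < idx j)%N by rewrite /idx /= eq_sym => /negPf ->.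
have idx_inj : injective idx.
  move=> j k /succn_inj e.
  have in_ l : l \in i :: enum 'I_n by rewrite inE mem_enum orbT.
  by rewrite -(nth_index i (in_ j)) e nth_index.
pose g j : R := if j == z then \sum_(k | k != z) (idx k)%:R else - (idx j)%:R.
have g0 : \sum_j g j = 0.
  rewrite (bigD1 z) //= {1}/g eqxx -big_split /= big1 // => k kz.
  by rewrite /g (negPf kz) subrr.
have gneg j : j != z -> g j < 0.
  by move=> jz; rewrite /g (negPf jz) oppr_lt0 ltr0n.
have gz : 0 < g z.
  by rewrite /g eqxx (bigD1 i) //= ltr_pwDl ?ltr0n ?sumr_ge0.
have [xi xiE] := deviation_onto g0; exists xi; split=> [x y|||].
- have up_inj j k : g j = g k -> j = k.
    have [->|jz] := eqVneq j z; have [->|kz] := eqVneq k z => //.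
    + by move=> e; have := gneg _ kz; rewrite -e ltNge ltW.
    + by move=> e; have := gneg _ jz; rewrite e ltNge ltW.
    rewrite /g (negPf jz) (negPf kz) => /oppr_inj/eqP.
    by rewrite eqr_nat => /eqP/idx_inj.
  have gn0 j : g j != 0.
    have [->|jz] := eqVneq j z; first by rewrite gt_eqF.
    by rewrite lt_eqF ?gneg.
  case: (unliftP top x) => [j ->|->]; case: (unliftP top y) => [k ->|->] //.
  + by rewrite !xiE => /up_inj ->.
  + by rewrite xiE deviation_top => /eqP; rewrite (negPf (gn0 _)).
  + by rewrite xiE deviation_top => /esym/eqP; rewrite (negPf (gn0 _)).
- by rewrite xiE.
- by move=> j jz; rewrite xiE gneg.
- move=> j jz ji; rewrite !xiE /g (negPf jz) (negPf iz) ltrN2 ltr_nat.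
  by apply: leq_trans (idxi _ ji); rewrite /idx /= eqxx.
Qed.

Section EqualFaces.
Variables r r' : 'I_n.+1 -> nat.
Hypothesis rmax : forall x, (r x <= r top)%N.
Hypothesis rmax' : forall x, (r' x <= r' top)%N.
Hypothesis eq_faces : face_of R r = face_of R r'.

Lemma eq_face_of_up i j : (3 <= n)%N ->
  (r (up i) < r (up j))%N -> (r' (up i) < r' (up j))%N.
Proof.
move=> n3 rij; have ij : i != j by apply: contraTneq rij => ->; rewrite ltnn.
(* A third element z can carry the positive deviation, so that i and j are both
   below the mean and neither is moved. *)
have [z zij] : exists z, z \notin [set i; j].
  apply/existsP; rewrite -negb_forall; apply/negP => /forallP all_ij.
  have : (#|'I_n| <= #|[set i; j]|)%N.
    by apply/subset_leq_card/subsetP => z _.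
  by rewrite card_ord cards2 ij leqNgt n3.
move: zij; rewrite !inE negb_or => /andP[zi zj].
rewrite eq_sym in zi; rewrite eq_sym in zj.
have [xi [dinj zpos neg maxi]] := generic_direction zi.
have := eq_face_of_subrank i j rmax rmax' eq_faces dinj.
have nm s k : k != z -> moved s xi (up k) = false.
  by move=> /neg dk; rewrite /moved (lt_gtF dk) andbF.
rewrite !subrankE /lexlt /split_rank !nm // !ltnS rij /= eqSS.
have := maxi j zj; rewrite eq_sym => /(_ ij) /lt_gtF ->.
by rewrite andbF orbF => <-.
Qed.

(** In a generic direction with j alone above the mean, j ends up before i
exactly when j belongs to the last part. *)
Lemma eq_face_of_top i j : (3 <= n)%N ->
  (r (up i) < r top)%N -> r (up j) = r top -> r' (up j) = r' top.
Proof.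
move=> n3 ri rj; apply/eqP; apply: contraT => rj'.
have ij : i != j by apply: contraTneq ri => ->; rewrite rj ltnn.
have rij' : (r' (up i) < r' (up j))%N by apply: eq_face_of_up; rewrite // rj.
have [xi [dinj jpos neg _]] := generic_direction ij.
have := eq_face_of_subrank j i rmax rmax' eq_faces dinj.
rewrite !subrankE /lexlt /split_rank /moved rj eqxx jpos (ltn_eqF ri) (negPf rj') /=.
rewrite (lt_gtF (neg _ ij)) andbF /= !ltnS.
by rewrite eqSS ltnNge (ltnW rij') gtn_eqF.
Qed.

End EqualFaces.

(** The comparison with n+1 is read off by placing an element of the last part
before one outside it, so both ranks must leave something outside. *)
Lemma face_of_inj r r' : (3 <= n)%N ->
  (forall x, r x <= r top)%N -> (forall x, r' x <= r' top)%N ->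
  (exists i, (r (up i) < r top)%N) -> (exists i, (r' (up i) < r' top)%N) ->
  face_of R r = face_of R r' ->
  forall x y, (r x < r y)%N = (r' x < r' y)%N.
Proof.
move=> n3 rmax rmax' [i0 ri0] [i0' ri0'] E x y.
case: (unliftP top x) => [i ->|->]; last by rewrite !ltnNge rmax rmax'.
case: (unliftP top y) => [j ->|->].
  by apply/idP/idP; apply: eq_face_of_up.
rewrite !ltn_neqAle rmax rmax' !andbT; congr (~~ _); apply/eqP/eqP.
  exact: (eq_face_of_top rmax rmax' E n3 ri0).
exact: (eq_face_of_top rmax' rmax (esym E) n3 ri0').
Qed.

(** By injectivity the face in direction xi has the same label as the whole, so
xi cannot separate two elements of one part. *)
Lemma fixed_face r xi : (3 <= n)%N -> (forall x, r x <= r top)%N ->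
  vface xi (face_of R r) = face_of R r ->
  forall x y, r x = r y -> deviation xi x = deviation xi y.
Proof.
move=> n3 rmax; rewrite vface_face_of // => E.
have smax x : (subrank r xi x <= subrank r xi top)%N by exact: subrank_max.
have eq_up i j : r (up i) = r (up j) -> deviation xi (up i) = deviation xi (up j).
  move=> rij; have le k l : r (up k) = r (up l) ->
      ~~ (subrank r xi (up k) < subrank r xi (up l))%N.
    by move=> rkl; apply/negP => /(eq_face_of_up smax rmax E n3); rewrite rkl ltnn.
  have := le i j rij; have := le j i (esym rij).
  rewrite !subrankE /lexlt /split_rank /moved rij.
  case: (r (up j) == r top) => /=; last first.
    by rewrite ltnn eqxx /=; case: ltgtP.
  by case: (ltP 0 (deviation xi (up i))) => di;
    case: (ltP 0 (deviation xi (up j))) => dj //=;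
    rewrite ?ltnn ?eqxx /=; case: ltgtP.
have eq_top i : r (up i) = r top -> deviation xi (up i) = 0.
  move=> ri.
  (* If no element is outside the last part, all deviations agree and sum to 0. *)
  have [/existsP[k rk]|] := boolP [exists k, r (up k) != r top]; last first.
    rewrite negb_exists => /forallP all_top.
    have allE j : deviation xi (up j) = deviation xi (up i).
      by apply: eq_up; rewrite ri; apply/eqP; have := all_top j; rewrite negbK.
    have := sum_deviation xi; under eq_bigr => j _ do rewrite allE.
    rewrite sumr_const card_ord => /eqP; rewrite mulrn_eq0 => /orP[/eqP n0|/eqP //].
    by exfalso; move: n3; rewrite (n0 : n = 0%N).
  have {}rk : (r (up k) < r top)%N by rewrite ltn_neqAle rk rmax.
  have := eq_face_of_top rmax smax (esym E) n3 rk ri => si.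
  have := subrankE r xi (up i) top; have := subrankE r xi top (up i).
  rewrite si ltnn /lexlt /split_rank moved_top deviation_top /moved ri eqxx /=.
  by case: ltgtP => //=; rewrite ?ltnn ?eqxx.
move=> x y; case: (unliftP top x) => [i ->|->];
  case: (unliftP top y) => [j ->|->] //.
- exact: eq_up.
- by move=> /eq_top ->; rewrite deviation_top.
- by move=> /esym/eq_top ->; rewrite deviation_top.
Qed.

(** * Directions realizing refinements *)
Lemma rank_refines_subrank r xi : rank_refines top (subrank r xi) r.
Proof.
exists (moved r xi); split; first exact: moved_top.
  by move=> x /andP[/eqP].
by move=> x y xy; rewrite subrankE /lexlt xy.
Qed.

(** It is enough to prescribe signs on the last part and the order inside each
part of the split rank, since the order between these parts is forced. *)
Lemma subrank_eq r r' mv xi :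
  (forall x, moved r xi x = mv x) ->
  (forall x y, (split_rank mv r x < split_rank mv r y)%N -> (r' x < r' y)%N) ->
  (forall x y, split_rank mv r x = split_rank mv r y ->
     (deviation xi x < deviation xi y) = (r' x < r' y)%N) ->
  forall x y, (subrank r xi x < subrank r xi y)%N = (r' x < r' y)%N.
Proof.
move=> mvE fin tie x y; rewrite subrankE /lexlt.
have E z : split_rank (moved r xi) r z = split_rank mv r z.
  by rewrite /split_rank mvE.
rewrite !E; case: ltngtP => [/fin -> //|/fin yx|/tie //].
by rewrite ltnNge ltnW.
Qed.

(** The only constraint on the deviations is that they sum to 0; as some element
is outside the last part, it can be met by adding a constant c to all
deviations outside the last part, which affects no relevant comparison. *)
Lemma refinement_direction r r' :
  (forall x, r x <= r top)%N -> (forall x, r' x <= r' top)%N ->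
  (exists i, (r (up i) < r top)%N) -> rank_refines top r' r ->
  exists xi, forall x y, (subrank r xi x < subrank r xi y)%N = (r' x < r' y)%N.
Proof.
move=> rmax rmax' [i0 ri0] [mv [mvtop mvr fin]].
pose h x : R := if mv x then (r' x).+1%:R else (r' x)%:R - (r' top)%:R.
pose N : R := \sum_(i | r (up i) != r top) 1.
have N0 : 0 < N.
  by rewrite /N (bigD1 i0) ?ltn_eqF //= ltr_pwDl ?ltr01 ?sumr_ge0.
pose c := - (\sum_i h (up i)) / N.
pose g x := h x + (if r x == r top then 0 else c).
have g0 : \sum_i g (up i) = 0.
  rewrite big_split /=.
  rewrite [X in _ + X](eq_bigr (fun i => if r (up i) != r top then c * 1 else 0)).
    by rewrite -big_mkcond /= -mulr_sumr /c divfK ?gt_eqF // subrr.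
  by move=> i _; case: eqP; rewrite ?mulr1.
have [xi xiE'] := deviation_onto g0.
have xiE x : deviation xi x = g x.
  case: (unliftP top x) => [i ->|->]; first by rewrite xiE'.
  by rewrite deviation_top /g /h mvtop eqxx subrr addr0.
exists xi; apply: (subrank_eq (mv := mv)) => // [x|x y].
  rewrite /moved xiE /g; case: eqP => [_|rx] /=; last first.
    by apply/esym/negP => /mvr.
  rewrite addr0 /h; case: ifP => _; first by rewrite ltr0n.
  by apply/negbTE; rewrite -leNgt subr_le0 ler_nat.
rewrite !xiE /g /h /split_rank.
case mx: (mv x); case my: (mv y) => //.
  by rewrite !mvr // eqxx !addr0 ltr_nat.
by case=> ->; rewrite ltrD2r ltrD2r ltr_nat.
Qed.

(** Here the last part is everything, and signs matter for all elements.  The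
sum is made 0 by scaling the positive values, which is possible because i0
ensures that there are positive values and j0 that there are negative ones. *)
Lemma proper_direction r' :
  (forall x, r' x <= r' top)%N ->
  (exists i j, (r' (up i) < r' (up j) < r' top)%N) ->
  exists2 xi, forall c, xi <> c *: ones R n &
    forall x y, (subrank (fun=> 0%N) xi x < subrank (fun=> 0%N) xi y)%N =
                (r' x < r' y)%N.
Proof.
move=> rmax' [i0 [j0 /andP[ij jt]]].
pose mv x := (r' x <= r' (up i0))%N.
pose A : R := \sum_(i | mv (up i)) (r' (up i)).+1%:R.
pose B : R := \sum_(i | ~~ mv (up i)) ((r' top)%:R - (r' (up i))%:R).
have A0 : 0 < A.
  by rewrite /A (bigD1 i0) /mv //= ltr_pwDl ?ltr0n ?sumr_ge0.
have B0 : 0 < B.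
  rewrite /B (bigD1 j0) /mv -?ltnNge //= ltr_pwDl ?subr_gt0 ?ltr_nat //.
  by rewrite sumr_ge0 // => k _; rewrite subr_ge0 ler_nat.
pose g x : R := if mv x then B / A * (r' x).+1%:R else (r' x)%:R - (r' top)%:R.
have g0 : \sum_i g (up i) = 0.
  rewrite (bigID (fun i => mv (up i))) /=.
  have -> : \sum_(i | mv (up i)) g (up i) = B / A * A.
    by rewrite mulr_sumr; apply: eq_bigr => i mi; rewrite /g mi.
  rewrite divfK ?gt_eqF // -big_split /= big1 // => i mi.
  by rewrite /g (negPf mi) addrA subrK subrr.
have BA0 : 0 < B / A by rewrite divr_gt0.
have [xi xiE'] := deviation_onto g0.
have mtop : mv top = false by rewrite /mv leqNgt (ltn_trans ij jt).
have xiE x : deviation xi x = g x.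
  case: (unliftP top x) => [i ->|->]; first by rewrite xiE'.
  by rewrite deviation_top /g mtop subrr.
have mvE x : (0 < g x) = mv x.
  rewrite /g; case: ifP => _; first by rewrite mulr_gt0 ?ltr0n.
  by apply/negbTE; rewrite -leNgt subr_le0 ler_nat.
exists xi => [c xic|].
  have : 0 < deviation xi (up i0) by rewrite xiE mvE /mv.
  rewrite deviation_up xic !mxE mulr1 (eq_bigr (fun=> c)).
    by rewrite sumr_const card_ord mulr_natl subrr ltxx.
  by move=> k _; rewrite !mxE mulr1.
apply: (subrank_eq (mv := mv)) => [x|x y|x y].
- by rewrite /moved eqxx xiE mvE.
- rewrite /split_rank; case mx: (mv x); case my: (mv y) => //= _.
  by apply: leq_ltn_trans mx _; rewrite ltnNge -/(mv y) my.
- rewrite !xiE /g /split_rank; case mx: (mv x); case my: (mv y) => //= _.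
    by rewrite ltr_pM2l // ltr_nat.
  by rewrite ltrD2r ltr_nat.
Qed.

End EqualityOfFaces.

(** * Dimensions of the faces *)
Section Dimension.
Variables (R : realFieldType) (n : nat).
Local Notation V := 'rV[R]_n.
Local Notation top := (@ord_max n).
Local Notation up := (lift (@ord_max n)).
Implicit Types (xi : V) (r : 'I_n.+1 -> nat) (x y : 'I_n.+1) (i j : 'I_n).

Definition left_kernel k (U : 'M[R]_(n, k)) : {vspace V} :=
  lker (linfun (mulmxr U) : 'Hom(V, 'rV_k)).

Lemma mem_left_kernel k (U : 'M[R]_(n, k)) v : (v \in left_kernel U) = (v *m U == 0).
Proof. by rewrite memv_ker lfunE. Qed.

Lemma dim_left_kernel k (U : 'M[R]_(n, k)) (E : 'M[R]_(k, n)) :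
  E *m U = 1%:M -> \dim (left_kernel U) = (n - k)%N.
Proof.
move=> EU; pose f : 'Hom(V, 'rV_k) := linfun (mulmxr U).
have := limg_ker_dim f fullv.
rewrite capfv dimvf /= /dim /= mul1n.
have -> : (f @: fullv)%VS = fullv.
  apply/eqP; rewrite eqEsubv subvf /=; apply/subvP => v _.
  apply/memv_imgP; exists (v *m E); first exact: memvf.
  by rewrite lfunE /= -mulmxA EU mulmx1.
rewrite dimvf /= /dim /= mul1n -/(left_kernel U) => e.
by rewrite -[RHS](congr1 (subn^~ k) e) addnK.
Qed.

Lemma dotv_mulmx (v xi : V) : dotv v xi = (v *m xi^T) ord0 ord0.
Proof. by rewrite mxE; apply: eq_bigr => i _; rewrite mxE. Qed.

Lemma left_kernel_orthogonal k (U : 'M[R]_(n, k)) xi (c : 'cV[R]_k) v :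
  xi^T = U *m c -> v \in left_kernel U -> dotv v xi = 0.
Proof.
by rewrite mem_left_kernel dotv_mulmx => -> /eqP vU; rewrite mulmxA vU mul0mx mxE.
Qed.

Section NormalizedRank.
Variable r : 'I_n.+1 -> nat.
Hypothesis rmax : forall x, (r x <= r top)%N.
Hypothesis rpos : (0 < r top)%N.
Hypothesis ronto : forall b, (b < r top)%N -> exists i, r (up i) = b.

Let N : R := \sum_(i | r (up i) != r top) 1.

Let N_gt0 : 0 < N.
Proof.
have [i ri] := ronto rpos.
by rewrite /N (bigD1 i) ?ri ?neq_ltn ?rpos //= ltr_pwDl ?ltr01 ?sumr_ge0.
Qed.

Let nE : n%:R = N + \sum_(i | ~~ (r (up i) != r top)) 1.
Proof.
transitivity (\sum_(i < n) 1 : R); first by rewrite sumr_const card_ord.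
exact: (bigID (fun i => r (up i) != r top)).
Qed.

(** The columns span the space of directions breaking no tie of r: such a xi is
given by its values on the parts other than the last one, and its value on the
last part is then the mean of all coordinates, which is also the mean of the
coordinates outside the last part. *)
Definition blocks_mx : 'M[R]_(n, r top) := \matrix_(i, b)
  if r (up i) == r top then (\sum_(j | r (up j) != r top) (r (up j) == b)%:R) / N
  else (r (up i) == b)%:R.

Lemma dim_block_kernel : \dim (left_kernel blocks_mx) = (n - r top)%N.
Proof.
have [f fE] := choice (fun b : 'I_(r top) => ronto (ltn_ord b)).
apply: (@dim_left_kernel _ _ (\matrix_(b, i) (i == f b)%:R)).
apply/matrixP => b b'; rewrite !mxE (bigD1 (f b)) //= big1 => [|i ib].
  by rewrite !mxE eqxx mul1r addr0 fE ltn_eqF.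
by rewrite !mxE (negPf ib) mul0r.
Qed.

(** All segments occurring in face_of r are parallel to the common kernel of the
directions that break no tie. *)
Lemma vdim_face_of_le : (vdim (face_of R r) <= n - r top)%N.
Proof.
rewrite -dim_block_kernel; apply: vdim_le.
  apply: in_translateD; first exact: in_translate_point.
  apply: in_translate_sum => i _; apply: in_translate_sum => j _.
  rewrite /edge; case: ltngtP => rij; try exact: in_translate_point.
  apply: in_translate_segment; rewrite mem_left_kernel mulmxBl subr_eq0 -!rowE.
  by apply/eqP/rowP => b; rewrite !mxE rij.
apply: in_translate_sum => i /eqP ri; apply: in_translate_segment.
rewrite sub0r memvN mem_left_kernel; apply/eqP/rowP => b.
pose xi := (col b blocks_mx)^T.
have -> : (Rvec R i *m blocks_mx) ord0 b = dotv (Rvec R i) xi.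
  by rewrite mxE; apply: eq_bigr => j _; rewrite !mxE.
have -> : dotv (Rvec R i) xi = deviation xi (up i) by rewrite /deviation liftK.
rewrite deviation_up [RHS]mxE (bigID (fun j => r (up j) != r top)) /=.
have xiM j : r (up j) = r top -> xi ord0 j = xi ord0 i.
  by move=> rj; rewrite !mxE rj ri.
rewrite [X in _ - (_ + X)](eq_bigr (fun=> xi ord0 i * 1)); last first.
  by move=> j; rewrite negbK mulr1 => /eqP; exact: xiM.
have -> : \sum_(j | r (up j) != r top) xi ord0 j = N * xi ord0 i.
  rewrite !mxE ri eqxx mulrC divfK ?gt_eqF //.
  by apply: eq_bigr => j rj; rewrite !mxE (negPf rj).
by rewrite -mulr_sumr mulrC [N * _]mulrC -mulrDr -nE subrr.
Qed.

Lemma vdim_face_of_ge : (3 <= n)%N -> (n - r top <= vdim (face_of R r))%N.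
Proof.
move=> n3; rewrite -dim_block_kernel.
apply: vdim_ge => xi /(fixed_face n3 rmax) dev v.
have [f fE] := choice (fun b : 'I_(r top) => ronto (ltn_ord b)).
pose c : 'cV[R]_(r top) := \col_b xi ord0 (f b).
have xi_f i (ri : (r (up i) < r top)%N) : xi ord0 i = c (Ordinal ri) ord0.
  by rewrite mxE; apply/deviation_eq/dev; rewrite fE.
have sum_c i : r (up i) != r top ->
    \sum_(b < r top) (r (up i) == b)%:R * c b ord0 = xi ord0 i.
  move=> ri; have {}ri : (r (up i) < r top)%N by rewrite ltn_neqAle ri rmax.
  rewrite (bigD1 (Ordinal ri)) //= eqxx mul1r -xi_f big1 ?addr0 // => b bi.
  rewrite [_ == _](_ : _ = false) ?mul0r //; apply/negbTE.
  by apply: contra bi => /eqP rb; apply/eqP/val_inj.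
apply: (@left_kernel_orthogonal _ _ _ c).
apply/colP => i; rewrite !mxE.
have [ri|ri] := eqVneq (r (up i)) (r top); last first.
  by rewrite -sum_c //; apply: eq_bigr => b _; rewrite [in RHS]mxE (negPf ri).
under eq_bigr => b _ do rewrite [blocks_mx _ _]mxE ri eqxx mulrAC mulr_suml.
rewrite -mulr_suml exchange_big /= (eq_bigr (fun j => xi ord0 j)) => [|j /sum_c //].
apply: (canRL (mulfK _)); rewrite ?gt_eqF //.
have := dev _ _ ri; rewrite deviation_top deviation_up => /eqP.
rewrite subr_eq0 (bigID (fun j => r (up j) != r top)) /=.
rewrite [X in _ + X](eq_bigr (fun=> xi ord0 i * 1)); last first.
  move=> j; rewrite negbK mulr1 => /eqP rj; have := dev (up i) (up j).
  by rewrite ri rj => /(_ erefl)/deviation_eq.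
by rewrite -mulr_sumr mulrC nE mulrDr => /eqP/addIr.
Qed.

Lemma vdim_face_of : (3 <= n)%N -> vdim (face_of R r) = (n - r top)%N.
Proof.
by move=> n3; apply/eqP; rewrite eqn_leq vdim_face_of_le vdim_face_of_ge.
Qed.

End NormalizedRank.

(** The directions fixing the whole polytope are constant vectors, so the bound
is the dimension of the hyperplane of vectors with coordinate sum 0. *)
Lemma vdim_face_of_const : (3 <= n)%N ->
  (n.-1 <= vdim (face_of R (fun _ : 'I_n.+1 => 0)))%N.
Proof.
move=> n3; have n0 : (0 < n)%N by exact: leq_trans n3.
pose i0 := Ordinal n0; pose U : 'M[R]_(n, 1) := const_mx 1.
rewrite -subn1 -(@dim_left_kernel _ U (delta_mx ord0 i0)); last first.
  by rewrite -rowE; apply/matrixP => i j; rewrite !mxE !ord1 eqxx.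
apply: vdim_ge => xi /fixed_face dev v.
apply: (@left_kernel_orthogonal _ _ _ (\col__ xi ord0 i0)).
apply/colP => i; rewrite !mxE big_ord1 !mxE mul1r.
exact/deviation_eq/dev.
Qed.

Lemma cyclopermutohedronE : cyclopermutohedron R n = face_of R (fun=> 0%N).
Proof.
rewrite /cyclopermutohedron /face_of vdiffE vembD [vemb (ppoint _) + _]addrC.
rewrite !vemb_sum.
congr (_ + _ - _).
by apply: eq_bigr => i _; rewrite vemb_sum.
Qed.

End Dimension.

(** * Vertices of the complex as points *)
Section SortByKey.
Variables (n : nat) (k : 'I_n -> nat).

Let w := sort (relpre k leq) (enum 'I_n).

Let k_total : total (relpre k leq).
Proof. by move=> i j; exact: leq_total. Qed.

Let k_trans : transitive (relpre k leq).
Proof. by move=> j i l; exact: leq_trans. Qed.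

(** Stability of sorting: sorting an enumeration lists its level sets in
increasing order, each in the order of the enumeration. *)
Lemma flatten_levels m : (forall i, k i < m)%N ->
  flatten [seq [seq i <- enum 'I_n | k i == v] | v <- iota 0 m] = w.
Proof.
move=> km; transitivity (flatten [seq [seq i <- w | k i == v] | v <- iota 0 m]).
  congr flatten; apply: eq_map => v; rewrite filter_sort // sorted_sort //.
  apply/(pairwise_sorted)/(sub_in_pairwise (P := fun i => k i == v)
                              (r := fun _ _ => true)).
  - by move=> i j /eqP ki /eqP kj _; rewrite /= ki kj.
  - exact: filter_all.
  - by elim: (filter _ _) => //= i s ->; rewrite all_predT.
rewrite flatten_filter_key ?sort_sorted //; apply/all_filterP/allP => i _; exact: km.
Qed.

Lemma index_sort_key i : injective k -> index i w = #|[set j | (k j < k i)%N]|.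
Proof.
move=> kinj; have w_all j : j \in w by rewrite mem_sort mem_enum.
have uw : uniq w by rewrite sort_uniq enum_uniq.
have lt j l : (index j w < index l w)%N -> (k j < k l)%N.
  have sw := sort_sorted k_total (enum 'I_n).
  move=> jl; have := sorted_ltn_index k_trans sw _ _ (w_all j) (w_all l) jl.
  rewrite /= leq_eqVlt => /orP[/eqP/kinj e|//]; by rewrite e ltnn in jl.
have ltE j l : (index j w < index l w)%N = (k j < k l)%N.
  apply/idP/idP => [/lt //|kjl]; rewrite ltnNge leq_eqVlt negb_or; apply/andP; split.
    apply: contraL kjl => /eqP/(congr1 (nth j w)); rewrite !nth_index // => ->.
    by rewrite ltnn.
  by apply: contraL kjl => /lt; rewrite -leqNgt; exact: ltnW.
have -> : [set j | (k j < k i)%N] = [set j in take (index i w) w].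
  by apply/setP => j; rewrite !inE in_take // ltE.
rewrite cardsE (card_uniqP _) ?take_uniq // size_takel //.
exact: index_size.
Qed.

End SortByKey.

Section Cells.
Variable n : nat.
Local Notation top := (@ord_max n).
Local Notation up := (lift (@ord_max n)).
Implicit Types (l : cpart 'I_n.+1) (c : cell n).

Lemma cyclic_rank_vertex_inj l : nparts l = n.+1 -> injective (cyclic_rank top l).
Proof.
rewrite (nparts_cyclic_rank top) => -[rtop].
have rlt x : (cyclic_rank top l x < n.+1)%N.
  by rewrite ltnS (leq_trans (cyclic_rank_max _ _ _)) // rtop.
pose f x := Ordinal (rlt x).
have /image_injP finj : #|image f 'I_n.+1| == #|'I_n.+1|.
  apply/eqP/eq_card => i; rewrite [RHS]inE; apply/codomP.
  have [|x xi] := @cyclic_rank_onto _ top l i; first by rewrite rtop -ltnS.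
  by exists x; apply: val_inj.
by move=> x y xy; apply: finj => //; apply: val_inj.
Qed.

(** In a 0-cell the part of n+1 is a singleton, so that cutting after this
singleton is cutting after the part of n+1. *)
Lemma cut_cyclic_rank l : nparts l = n.+1 ->
  cut l = sort (relpre (cyclic_rank top l \o up) leq) (enum 'I_n).
Proof.
move=> ln; have rinj := cyclic_rank_vertex_inj ln.
pose s := repr l; pose p := part_index (val s) top.
have partP A x : A \in val (cut_after top s) -> x \in A ->
    A = nth set0 (val (cut_after top s)) (cyclic_rank top l x).
  move=> As xA.
  have ai : (index A (val (cut_after top s)) < size (val (cut_after top s)))%N.
    by rewrite index_mem.
  rewrite -{1}(nth_index set0 As); congr nth.
  by apply/eqP; rewrite eq_sym -(mem_nth_part _ ai) nth_index.
have s_top : index [set top] (val s) = p.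
  have plt : (p < size (val s))%N by exact: part_index_lt.
  have -> : [set top] = nth set0 (val s) p.
    apply/setP => x; rewrite inE mem_nth_part //; apply/eqP/eqP => [-> //|xp].
    by apply: rinj; rewrite /cyclic_rank !cut_afterE xp -/p.
  by rewrite index_uniq //; have /ordered_partitionP[] := valP s.
rewrite /cut -/s s_top.
have sz : size (rot p.+1 (val s)) = n.+1 by rewrite size_rot; exact: ln.
rewrite -[X in flatten (map _ X)](mkseq_nth set0) -map_comp sz.
rewrite -(@flatten_levels _ _ n.+1) => [|i]; last first.
  by rewrite /= (leq_ltn_trans (cyclic_rank_max _ _ _)) // -nparts_cyclic_rank ln.
congr flatten; apply/eq_in_map => v; rewrite mem_iota add0n => /andP[_ vn] /=.
rewrite map_id; apply: eq_filter => i.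
by rewrite (@mem_nth_part _ (cut_after top s)) // sz.
Qed.

Lemma vertex_nparts c : complex_vertices n c -> nparts (val c) = n.+1.
Proof.
move=> /eqP; rewrite subn_eq0 => le; apply/eqP; rewrite eqn_leq le andbT.
by have := size_opart (repr (val c)); rewrite card_ord.
Qed.

Lemma phi_rank_vertex (R : realFieldType) c : complex_vertices n c ->
  phi R c = rank_vertex R (cyclic_rank top (val c)).
Proof.
move=> /vertex_nparts cn; apply/rowP => i.
rewrite !mxE cut_cyclic_rank // index_sort_key //.
by move=> j k /(cyclic_rank_vertex_inj cn)/(@lift_inj _ _ _ _).
Qed.

End Cells.

(** * The correspondence between cells and proper faces *)
Section Correspondence.
Variables (R : realFieldType) (n : nat) (n_ge3 : (3 <= n)%N).
Local Notation top := (@ord_max n).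
Local Notation up := (lift (@ord_max n)).
Local Notation K := (cyclopermutohedron R n).
Implicit Types (c : cell n) (r : 'I_n.+1 -> nat) (F : virtual R n).

Definition cell_rank c := cyclic_rank top (val c).
Definition cell_face c : virtual R n := face_of R (cell_rank c).

Lemma cell_rank_top c : (2 <= cell_rank c top)%N.
Proof. by have := valP c; rewrite (nparts_cyclic_rank top). Qed.

Lemma cell_rank_onto c b :
  (b < cell_rank c top)%N -> exists i, cell_rank c (up i) = b.
Proof.
move=> bt; have [x xb] := cyclic_rank_onto (ltnW bt).
case: (unliftP top x) => [i xi|xt]; first by exists i; rewrite -xi.
by move: bt; rewrite -xb xt ltnn.
Qed.

Lemma cell_rank_max c x : (cell_rank c x <= cell_rank c top)%N.
Proof. exact: cyclic_rank_max. Qed.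

(** Three parts leave two ranks below the largest one; this is what makes the
faces of cells proper and keeps refinements of cells among the cells. *)
Lemma cell_rank_levels c : exists i j,
  (cell_rank c (up i) < cell_rank c (up j) < cell_rank c top)%N.
Proof.
have c2 := cell_rank_top c.
have [i ri] := cell_rank_onto (ltnW c2); have [j rj] := cell_rank_onto c2.
by exists i, j; rewrite ri rj.
Qed.

Lemma cell_rank_lt_top c : exists i, (cell_rank c (up i) < cell_rank c top)%N.
Proof. by have [i [j /andP[ij jt]]] := cell_rank_levels c; exists j. Qed.

Lemma cell_face_inj : injective cell_face.
Proof.
move=> c c' /face_of_inj E; apply: val_inj; apply: (@cyclic_rank_inj _ top) => x y.
by apply: E => //; try exact: cell_rank_max; exact: cell_rank_lt_top.
Qed.

Lemma vdim_cell_face c : vdim (cell_face c) = cell_dim c.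
Proof.
rewrite /cell_dim (nparts_cyclic_rank top) subSS vdim_face_of //.
- exact: cell_rank_max.
- exact: ltnW (cell_rank_top c).
- exact: cell_rank_onto.
Qed.

Lemma cell_of_rank r : (forall x, r x <= r top)%N ->
  (exists i j, (r (up i) < r (up j) < r top)%N) ->
  exists c, forall x y, (cell_rank c x < cell_rank c y)%N = (r x < r y)%N.
Proof.
move=> rmax [i [j /andP[ij jt]]]; have [l lr] := cyclic_rank_surj rmax.
suff l3 : (3 <= nparts l)%N by exists (Sub l l3).
rewrite (nparts_cyclic_rank top) ltnS.
rewrite -lr in ij; rewrite -lr in jt.
exact: leq_ltn_trans (leq_ltn_trans _ ij) jt.
Qed.

(** Faces of cells are cells: two elements of distinct ranks below the largest
one are not moved, so that they keep the refined partition at three parts or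
more. *)
Lemma face_cell_face c xi :
  exists2 c', vface xi (cell_face c) = cell_face c' & cell_sub c' c.
Proof.
have cmax := cell_rank_max c; have [i [j /andP[ij jt]]] := cell_rank_levels c.
have [||c' c'E] := @cell_of_rank (subrank (cell_rank c) xi).
- by move=> x; exact: subrank_max.
- exists i, j; rewrite !subrankE /lexlt /split_rank moved_top /moved.
  by rewrite (ltn_eqF jt) (ltn_eqF (ltn_trans ij jt)) /= !ltnS ij jt.
exists c'.
  by rewrite /cell_face vface_face_of //; apply: eq_face_of => x y; rewrite c'E.
apply/(refines_cyclic_rank top).
have [mv [mv0 mvr fin]] := rank_refines_subrank (cell_rank c) xi.
by exists mv; split=> // x y xy; rewrite -/(cell_rank c') c'E fin.
Qed.

Lemma cell_sub_face c' c : cell_sub c' c <-> is_face (cell_face c') (cell_face c).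
Proof.
split=> [/(refines_cyclic_rank top) c'c|[xi]]; last first.
  by have [c'' -> c''c] := face_cell_face c xi; move=> /cell_face_inj ->.
have [xi xiE] := refinement_direction R (cell_rank_max c) (cell_rank_max c')
  (cell_rank_lt_top c) c'c.
exists xi; rewrite vface_face_of; last exact: cell_rank_max.
by apply: eq_face_of => x y; rewrite xiE.
Qed.

(** A non-constant direction has coordinates above and below the mean, so its
level sets, together with that of the extra element, are at least three. *)
Lemma proper_faceP F : proper_face F <-> exists c, F = cell_face c.
Proof.
split=> [[xi [xi_n1 ->]]|[c ->]]; last first.
  have [xi xi_n1 xiE] := proper_direction R (cell_rank_max c) (cell_rank_levels c).
  exists xi; split=> //; rewrite cyclopermutohedronE vface_face_of //.
  by apply: eq_face_of => x y; rewrite xiE.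
rewrite cyclopermutohedronE vface_face_of //.
have dev_n0 : exists i, deviation xi (up i) != 0.
  apply/existsP; apply: contraT; rewrite negb_exists => /forallP d0; exfalso.
  have n0 : (0 < n)%N by exact: leq_trans n_ge3.
  apply: (xi_n1 (xi ord0 (Ordinal n0))); apply/rowP => i; rewrite !mxE mulr1.
  have := d0 i; have := d0 (Ordinal n0); rewrite !negbK => /eqP d1 /eqP d2.
  by apply: deviation_eq; rewrite d1 d2.
have neg_ex (g : 'I_n -> R) :
    \sum_i g i = 0 -> (exists i, g i != 0) -> exists i, g i < 0.
  move=> g0 [i gi]; apply/existsP; apply: contraNT gi.
  rewrite negb_exists => /forallP pos.
  by apply/eqP/(psumr_eq0P _ g0) => // j _; rewrite leNgt.
have [j dj] := neg_ex _ (sum_deviation xi) dev_n0.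
have [i di] : exists i, - deviation xi (up i) < 0.
  apply: neg_ex; first by rewrite sumrN sum_deviation oppr0.
  by have [i di] := dev_n0; exists i; rewrite oppr_eq0.
rewrite oppr_lt0 in di.
have [x||c cE] := @cell_of_rank (subrank (fun=> 0%N) xi).
- exact: subrank_max.
- exists i, j; rewrite !subrankE /lexlt /split_rank moved_top /moved deviation_top.
  by rewrite /= di (lt_gtF dj) dj.
by exists c; apply: eq_face_of => x y; rewrite cE.
Qed.

Lemma face_cyclopermutohedron F : is_face F K -> proper_face F \/ F = K.
Proof.
move=> [xi ->].
have [[c ->]|xi_n1] := pselect (exists a : R, xi = a *: ones R n); last first.
  by left; exists xi; split=> // c xic; apply: xi_n1; exists c.
right; rewrite cyclopermutohedronE vface_face_of //; apply: eq_face_of => x y.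
have d0 z : deviation (c *: ones R n) z = 0.
  case: (unliftP top z) => [i ->|->]; last exact: deviation_top.
  rewrite deviation_up (eq_bigr (fun=> c)) => [|k _]; last by rewrite !mxE mulr1.
  by rewrite !mxE mulr1 sumr_const card_ord mulr_natl subrr.
by rewrite subrankE /lexlt /split_rank /moved !d0 ltxx andbF.
Qed.

Lemma vdim_cyclopermutohedron : (n.-1 <= vdim K)%N.
Proof. by rewrite cyclopermutohedronE vdim_face_of_const. Qed.

(** The cyclopermutohedron is its own face in constant directions, and only its
dimension n - 1 excludes it here. *)
Lemma low_dim_face F : (vdim F <= n - 2)%N ->
  is_face F K <-> exists c, F = cell_face c.
Proof.
move=> Fn; split=> [/face_cyclopermutohedron[/proper_faceP//|FK]|]; last first.
  by move=> /proper_faceP[xi [_ ->]]; exists xi.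
by move: Fn vdim_cyclopermutohedron; rewrite FK; lia.
Qed.

Lemma cell_face_vertex c : complex_vertices n c -> cell_face c = vpoint (phi R c).
Proof.
move=> c0; rewrite phi_rank_vertex // -face_of_vertex //.
exact/cyclic_rank_vertex_inj/vertex_nparts.
Qed.

(** Vertices are the faces of dimension 0, hence the 0-cells refining c. *)
Lemma vertices_cell_face c :
  vertices (cell_face c) = [set vpoint (phi R v) | v in cell_vertices c]%classic.
Proof.
apply/seteqP; split=> [F [[xi ->]]|_ [v [v0 vc] <-]].
  have [c' -> c'c] := face_cell_face c xi; rewrite vdim_cell_face => c'0.
  by exists c'; [split | rewrite -cell_face_vertex].
rewrite -cell_face_vertex //; split; first exact/cell_sub_face.
by rewrite vdim_cell_face.
Qed.

Lemma vpoint_phi_inj v w : complex_vertices n v -> complex_vertices n w ->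
  vpoint (phi R v) = vpoint (phi R w) -> v = w.
Proof. by move=> v0 w0; rewrite -!cell_face_vertex // => /cell_face_inj. Qed.

(** The value on virtual polytopes that are not faces of cells is arbitrary. *)
Definition face_label F : cpart 'I_n.+1 :=
  if pselect (exists c, F = cell_face c) is left cF then val (projT1 (cid cF))
  else \pi_(cpart 'I_n.+1)%qT
         (projT1 (cid (part_index_surj (fun _ : 'I_n.+1 => 0%N)))).

Lemma face_label_cell c : face_label (cell_face c) = val c.
Proof.
rewrite /face_label; case: pselect => [cF|]; last by case; exists c.
by case: (cid cF) => c' /= /cell_face_inj ->.
Qed.

End Correspondence.

Local Open Scope classical_set_scope.

Theorem theorem1 (R : realType) (n : nat) (hn : (3 <= n)%N) :
  set_bij (complex_vertices n) (vertices (cyclopermutohedron R n))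
    (fun v => vpoint (phi R v)) /\
  exists (Phi : cell n -> virtual R n)
         (label : virtual R n -> cpart 'I_n.+1),
    [/\ [/\ set_bij [set: cell n] [set F | proper_face F] Phi,
            forall c, vdim (Phi c) = cell_dim c,
            forall c' c, cell_sub c' c <-> is_face (Phi c') (Phi c),
            forall v, complex_vertices n v -> Phi v = vpoint (phi R v) &
            forall c, label (Phi c) = val c],
        forall V : set (cell n), V `<=` complex_vertices n ->
          (exists c, V = cell_vertices c) <->
          (exists F, proper_face F /\
             [set vpoint (phi R v) | v in V] = vertices F),
        forall k : nat, (k <= n - 2)%N ->
          set_bij [set F | is_face F (cyclopermutohedron R n) /\ vdim F = k]
                  [set l : cpart 'I_n.+1 | nparts l = n - k + 1]%N label &
        forall F' F : virtual R n, proper_face F' -> proper_face F ->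
          is_face F' F <-> refines (label F') (label F)].
Proof.
have low (c : cell n) : cell_dim c = 0%N -> (vdim (cell_face R c) <= n - 2)%N.
  by move=> c0; rewrite vdim_cell_face // c0.
split.
  split=> [v v0|v w|F [FK F0]].
  - rewrite /= -cell_face_vertex //; split; last by rewrite vdim_cell_face.
    by apply/low_dim_face => //; [exact: low | exists v].
  - by rewrite !in_setE; exact: vpoint_phi_inj.
  - move: FK => /(low_dim_face hn)[|c Fc]; first by rewrite F0.
    have c0 : complex_vertices n c.
      by rewrite /complex_vertices /= -(vdim_cell_face R hn) -Fc.
    by exists c => //; rewrite Fc cell_face_vertex.
exists (@cell_face R n), (@face_label R n); split.
- split.
  + split=> [c _|c c' _ _|F /(proper_faceP hn)[c ->]].
    * by apply/(proper_faceP hn); exists c.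
    * exact: cell_face_inj.
    * by exists c.
  + by move=> c; exact: vdim_cell_face.
  + by move=> c' c; exact: cell_sub_face.
  + by move=> v; exact: cell_face_vertex.
  + by move=> c; exact: face_label_cell.
- move=> V V0; split=> [[c ->]|[F [/(proper_faceP hn)[c ->]]]].
    exists (cell_face R c); split; first by apply/(proper_faceP hn); exists c.
    by rewrite vertices_cell_face.
  rewrite vertices_cell_face // => E; exists c; apply/seteqP; split=> v Vv.
    have : [set vpoint (phi R v) | v in V] (vpoint (phi R v)) by exists v.
    rewrite E => -[w [w0 wc]] /(vpoint_phi_inj hn w0 (V0 _ Vv)) <-.
    by split.
  have : [set vpoint (phi R v) | v in cell_vertices c] (vpoint (phi R v)).
    by exists v.
  by rewrite -E => -[w Vw] /(vpoint_phi_inj hn (V0 _ Vw)) <- //; case: Vv.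
- move=> k kn; split=> [F [FK Fk]|F F'|l lk].
  + move: FK => /(low_dim_face hn)[|c Fc]; first by rewrite Fk.
    rewrite /= Fc face_label_cell //; have := valP c; move: Fk.
    rewrite Fc vdim_cell_face // /cell_dim => <- /= c3.
    have := size_opart (repr (val c)); rewrite card_ord -/(nparts (val c)).
    by move: c3; move: (nparts _) => m; lia.
  + rewrite !in_setE => -[FK Fk] [FK' Fk'].
    move: FK => /(low_dim_face hn)[|c ->]; first by rewrite Fk.
    move: FK' => /(low_dim_face hn)[|c' ->]; first by rewrite Fk'.
    by rewrite !face_label_cell // => /val_inj ->.
  + have l3 : (3 <= nparts l)%N by rewrite lk; lia.
    pose c : cell n := Sub l l3.
    have ck : vdim (cell_face R c) = k.
      by rewrite vdim_cell_face // /cell_dim SubK; move: lk => /= ->; lia.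
    exists (cell_face R c); last by rewrite face_label_cell.
    by split=> //; apply/(low_dim_face hn); [rewrite ck | exists c].
- move=> F' F /(proper_faceP hn)[c' ->] /(proper_faceP hn)[c ->].
  rewrite !face_label_cell //.
  exact: iff_sym (cell_sub_face R hn c' c).
Qed.
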